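(* There exist constants $C>0$, $A>0$ and $x_0$ such that for all real $x\ge x_0$ and all integers $m$ with $1\le m\le \frac{\log_2 x}{\log_3 x}$, $$\Bigl|\sum_{n\le x} d(n)\,\exp\bigl(2\pi i n\, e^{-2\pi m}\bigr)\Bigr|\;\le\; A\,x\log x\,\exp\Bigl(-C\,\frac{\log_2 x}{\log_3 x}\Bigr).$$
   Context: $d(n)$ denotes the number of positive divisors of $n$. For $j\ge2$, $\log_j x=\log(\log_{j-1}x)$ with $\log_1 x=\log x$ (iterated natural logarithm). *)

(* Defs.v *)
From Stdlib Require Import Reals Lra Lia Arith List.
Import ListNotations.
Open Scope R_scope.

(* d(n): number of positive divisors of n (d(0) = 0, never used). *)
Definition ndivisors (n : nat) : nat :=
  length (filter (fun k => Nat.eqb (Nat.modulo n k) 0) (List.seq 1 n)).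

Fixpoint sum_1_to (f : nat -> R) (N : nat) : R :=
  match N with
  | O => 0
  | S k => sum_1_to f k + f (S k)
  end.

Definition div_exp_sum_re (t : R) (N : nat) : R :=
  sum_1_to (fun n => INR (ndivisors n) * cos (2 * PI * INR n * t)) N.
Definition div_exp_sum_im (t : R) (N : nat) : R :=
  sum_1_to (fun n => INR (ndivisors n) * sin (2 * PI * INR n * t)) N.

Definition cmod (a b : R) : R := sqrt (a * a + b * b).

(* Main.v *)
(** Write theta = exp(-2 pi m), L = log_2 x / log_3 x and e(y) = exp(2 pi i y).

    Sum estimate.  The hyperbola method reduces the sum to
    sum_{d <= sqrt N} U(d), where U(d) bounds progressions of e(d k theta), so that
    U(d) <= 2N/d and U(d) |sin(pi d theta)| <= 2.  Suppose
    |sin(pi t theta)| >= delta for all 1 <= t <= Q.  Then among Q consecutive d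
    at most one has |sin(pi d theta)| < delta/2, since two such d would differ by a
    t <= Q violating the hypothesis; hence the sum is
    O(sqrt N Q / delta + N log N / Q).  Take Q = 2^h with h the integer part of L.

    Lower bound for delta.  One needs a measure of irrationality of exp(2 pi m),
    which Gelfond's method provides.  If theta is very close to r = p/q, a
    pigeonhole argument gives a nonzero integer polynomial P(z, Y) such that
    P(a + ib, r^a) = 0 on a square grid of Gaussian integers.  As
    exp(-2 pi m (a + ib)) = theta^a, the function P(z, exp(-2 pi m z)) is almost
    zero on the grid, so by interpolation it is very small on the next larger grid;
    there P(a + ib, r^a) is a Gaussian integer up to a denominator q^(nK), hence
    vanishes.  Repeating this, P(a + ib, r^a) vanishes on a grid larger than the
    degrees of P allow.  To stay within polynomials, exp(w z) is replaced by
    (1 + w z/M)^M with M huge. *)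

Require Import Defs.
From Stdlib Require Import Reals Lra Lia Psatz Arith List.
From Coquelicot Require Rcomplements.
From mathcomp Require all_boot all_order all_algebra zify ring lra complex Rstruct.
Open Scope R_scope.

(** * Real estimates *)

Lemma Rabs_cos_sub1 v : Rabs (cos v - 1) <= v ^ 2 / 2.
Proof.
assert (Hs : Rabs (sin (v / 2)) <= Rabs (v / 2)).
{ destruct (Rtotal_order 0 (v / 2)) as [Hv|[Hv|Hv]].
  - rewrite (Rabs_right (v / 2)) by lra. apply Rabs_le; split.
    + destruct (Rle_lt_dec (v / 2) PI).
      * pose proof (sin_ge_0 (v / 2) ltac:(lra) ltac:(lra)). lra.
      * pose proof (SIN_bound (v / 2)). pose proof PI2_1. pose proof PI_RGT_0. lra.
    + left; apply sin_lt_x; lra.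
  - rewrite <- Hv, sin_0. lra.
  - rewrite (Rabs_left (v / 2)) by lra.
    assert (Hn : sin (v / 2) = - sin (- (v / 2))) by (rewrite sin_neg; ring).
    rewrite Hn, Rabs_Ropp. apply Rabs_le; split.
    + destruct (Rle_lt_dec (- (v / 2)) PI).
      * pose proof (sin_ge_0 (- (v / 2)) ltac:(lra) ltac:(lra)). lra.
      * pose proof (SIN_bound (- (v / 2))). pose proof PI2_1. pose proof PI_RGT_0. lra.
    + left; apply sin_lt_x; lra. }
assert (Hc : cos v - 1 = - (2 * (sin (v / 2) * sin (v / 2)))).
{ replace v with (2 * (v / 2)) at 1 by field. rewrite cos_2a_sin. ring. }
rewrite Hc, Rabs_Ropp, Rabs_right by nra.
apply Rsqr_le_abs_1 in Hs. unfold Rsqr in Hs. nra.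
Qed.

Lemma Rabs_sin_sub v : Rabs v <= 1 -> Rabs (sin v - v) <= v ^ 2.
Proof.
assert (H : forall t, 0 <= t <= 1 -> Rabs (sin t - t) <= t ^ 2).
{ intros t Ht. pose proof PI2_1.
  destruct (sin_bound t 0) as [Hl Hu]; try lra.
  unfold sin_approx, sin_term in Hl, Hu; simpl in Hl, Hu.
  apply Rabs_le; split; [nra|].
  destruct (Req_dec t 0) as [->|]; [rewrite sin_0; lra|].
  pose proof (sin_lt_x t ltac:(lra)). nra. }
intros Hv. destruct (Rle_lt_dec 0 v).
- rewrite Rabs_right in Hv by lra. apply H; lra.
- rewrite Rabs_left in Hv by lra.
  replace (sin v - v) with (- (sin (- v) - - v)) by (rewrite sin_neg; ring).
  rewrite Rabs_Ropp. replace (v ^ 2) with ((- v) ^ 2) by ring. apply H; lra.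
Qed.

(** The upper bound comes from exp(-u) >= 1 - u, which gives exp u <= 1 / (1 - u). *)
Lemma exp_sub_linear u : Rabs u <= 1 / 2 -> 0 <= exp u - 1 - u <= 2 * u ^ 2.
Proof.
intros Hu. pose proof (Rle_abs u) as H5. pose proof (Rle_abs (- u)) as H6.
rewrite Rabs_Ropp in H6.
pose proof (exp_ineq1_le u) as H1. pose proof (exp_ineq1_le (- u)) as H2.
pose proof (exp_pos u) as H3.
assert (H4 : exp u * exp (- u) = 1) by (rewrite <- exp_plus, Rplus_opp_r; apply exp_0).
split; [lra|].
assert (exp u * (1 - u) <= 1) by nra. nra.
Qed.

(** The l^1 form of |e^w - 1 - w| = O(|w|^2) at w = u + iv: the error of a single factor when e^(M
    w) is replaced by (1 + w)^M. *)
Lemma exp_cos_sin_sub_linear u v : Rabs u <= 1 / 2 -> Rabs v <= 1 / 2 ->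
  Rabs (exp u * cos v - 1 - u) + Rabs (exp u * sin v - v)
  <= 4 * (Rabs u + Rabs v) ^ 2.
Proof.
intros Hu Hv.
destruct (exp_sub_linear u Hu) as [He0 He].
pose proof (Rabs_cos_sub1 v) as Hc.
pose proof (Rabs_sin_sub v ltac:(lra)) as Hs.
pose proof (exp_pos u) as Hp.
pose proof (Rabs_pos u). pose proof (Rabs_pos v).
assert (Hu2 : u ^ 2 = Rabs u ^ 2) by (symmetry; apply pow2_abs).
assert (Hv2 : v ^ 2 = Rabs v ^ 2) by (symmetry; apply pow2_abs).
assert (Hexp : exp u <= 2).
{ pose proof (Rle_abs u). nra. }
assert (H1 : Rabs (exp u - 1) <= 2 * Rabs u).
{ replace (exp u - 1) with ((exp u - 1 - u) + u) by ring.
  eapply Rle_trans; [apply Rabs_triang|]. rewrite (Rabs_right (_ - _)) by lra. nra. }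
replace (exp u * cos v - 1 - u) with (exp u * (cos v - 1) + (exp u - 1 - u)) by ring.
replace (exp u * sin v - v) with (exp u * (sin v - v) + (exp u - 1) * v) by ring.
pose proof (Rabs_triang (exp u * (cos v - 1)) (exp u - 1 - u)) as T1.
pose proof (Rabs_triang (exp u * (sin v - v)) ((exp u - 1) * v)) as T2.
rewrite Rabs_mult, (Rabs_right (exp u)), (Rabs_right (exp u - 1 - u)) in T1 by lra.
rewrite !Rabs_mult, (Rabs_right (exp u)) in T2 by lra.
pose proof (Rabs_pos (cos v - 1)). pose proof (Rabs_pos (sin v - v)).
nra.
Qed.

Lemma exp_INR_mult n t : exp (INR n * t) = exp t ^ n.
Proof.
induction n as [|n IH]; [rewrite Rmult_0_l; apply exp_0|].
rewrite S_INR. simpl. rewrite <- IH, <- exp_plus. f_equal. ring.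
Qed.

Lemma one_plus_pow_le_exp t n : 0 <= t -> (1 + t) ^ n <= exp (INR n * t).
Proof.
intros Ht. rewrite exp_INR_mult. apply pow_incr. pose proof (exp_ineq1_le t). lra.
Qed.

Lemma exp_mono x y : x <= y -> exp x <= exp y.
Proof. intros [H|H]; [left; now apply exp_increasing | right; now rewrite H]. Qed.

(** Growth of exp(-2 pi m z) on the radius 6n, as a power of 2: [PI] <= 4 makes the exponent at most
    48 m n, and e <= 4 = 2^2 doubles it to 96 m n. *)
Lemma exp_2PI_le (m n s : nat) : (96 * m <= s)%nat ->
  exp (2 * PI * INR m * INR (6 * n)) <= 2 ^ (s * n).
Proof.
intros Hs. apply Rle_trans with (exp (INR (48 * m * n) * 1)).
- apply exp_mono. rewrite !mult_INR, Rmult_1_r.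
  replace (INR 6) with 6 by (simpl; ring). replace (INR 48) with 48 by (simpl; ring).
  pose proof PI_4. pose proof (pos_INR m). pose proof (pos_INR n).
  assert (0 <= INR m * INR n) by now apply Rmult_le_pos. nra.
- rewrite exp_INR_mult. apply Rle_trans with (4 ^ (48 * m * n)).
  + apply pow_incr. pose proof exp_le_3. pose proof (exp_pos 1). lra.
  + replace 4 with (2 ^ 2) by ring. rewrite <- pow_mult. apply Rle_pow; [lra|]. nia.
Qed.

(** exp(-2 pi m z) has period i, so on Gaussian integers only the real part matters and the values
    are powers of one real number. *)
Lemma exp_2PI_gaussian (m a b : nat) :
  exp (- (2 * PI * INR m) * INR a) = exp (- (2 * PI * INR m)) ^ a
  /\ cos (- (2 * PI * INR m) * INR b) = 1 /\ sin (- (2 * PI * INR m) * INR b) = 0.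
Proof.
split; [|split].
- rewrite Rmult_comm. apply exp_INR_mult.
- replace (- (2 * PI * INR m) * INR b) with (- (0 + 2 * INR (m * b) * PI))
    by (rewrite mult_INR; ring).
  rewrite cos_neg, cos_period. apply cos_0.
- replace (- (2 * PI * INR m) * INR b) with (- (0 + 2 * INR (m * b) * PI))
    by (rewrite mult_INR; ring).
  rewrite sin_neg, sin_period, sin_0. ring.
Qed.

Lemma two_PI_INR_ge0 m : 0 <= 2 * PI * INR m.
Proof. pose proof PI_RGT_0. pose proof (pos_INR m). nra. Qed.

Lemma exp_opp_le_pow2 n : exp (- INR n) <= / 2 ^ n.
Proof.
rewrite exp_Ropp. apply Rinv_le_contravar; [apply pow_lt; lra|].
rewrite <- (Rmult_1_r (INR n)), exp_INR_mult. apply pow_incr.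
pose proof (exp_ineq1_le 1). lra.
Qed.

(** * Gelfond's method *)

Module Gelfond.
Import all_boot all_order all_algebra.
Import zify ring lra.
Import Order.TTheory GRing.Theory Num.Theory.
Set Implicit Arguments.
Unset Strict Implicit.
Unset Printing Implicit Defensive.
Local Open Scope ring_scope.

(** Siegel's lemma by pigeonhole. Of the (X + 1)^|J| vectors with entries in [0, X], two have the
    same image: the images, shifted by |J| U X, lie in a box of (X^2 + 1)^|I| points, fewer than (X
    + 1)^(2 |I|). Their difference is the solution. *)
Lemma siegel (I J : finType) (U : nat) (A : I -> J -> int) :
  (0 < #|I|)%N -> (0 < U)%N -> #|J| = (2 * #|I|)%N ->
  (forall i j, `|A i j| <= U%:Z) ->
  exists c : J -> int,
    [/\ exists j, c j != 0, forall j, `|c j| <= (2 * #|J| * U)%:Z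
      & forall i, \sum_j A i j * c j = 0].
Proof.
move=> I_gt0 U_gt0 cardJ AU; set X := (2 * #|J| * U)%N.
have X_gt0 : (0 < X)%N by rewrite /X cardJ !muln_gt0 I_gt0 U_gt0.
pose f (v : {ffun J -> 'I_X.+1}) : {ffun I -> 'I_(X * X).+1} :=
  [ffun i => inord `|(\sum_j A i j * (v j)%:Z + (#|J| * U * X)%:Z)%R|%N].
have /injectivePn [v [v' vv' fvv']] : ~~ injectiveb f.
  apply/negP => /injectiveP /leq_card.
  rewrite !card_ffun !card_ord cardJ expnM leqNgt ltn_exp2r //; nia.
have sumle i (w : {ffun J -> 'I_X.+1}) :
    `|\sum_j A i j * (w j)%:Z| <= (#|J| * U * X)%:Z.
  apply: le_trans (ler_norm_sum _ _ _) _.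
  apply: le_trans (_ : \sum_(j : J) (U * X)%:Z <= _); last first.
    by rewrite sumr_const -mulnA -mulr_natl natz -PoszM.
  apply: ler_sum => j _; rewrite normrM PoszM ler_pM //.
  by have := ltn_ord (w j); lia.
exists (fun j => (v j)%:Z - (v' j)%:Z); split.
- apply/existsP; rewrite -negb_forall; apply: contra vv' => /forallP vv'.
  apply/eqP/ffunP => j; apply/val_inj.
  by move: (vv' j); rewrite subr_eq0 eqz_nat => /eqP.
- by move=> j; have := ltn_ord (v j); have := ltn_ord (v' j); lia.
- move=> i; move/ffunP/(_ i): fvv'; rewrite !ffunE => /(congr1 val).
  have := sumle i v; have := sumle i v'.
  under [X in _ -> _ -> _ -> X = _]eq_bigr do rewrite mulrBr.
  rewrite sumrB.
  set S := \sum_j _; set S' := \sum_j _; set B := (_ * X)%N.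
  have -> : (X * X = 2 * B)%N by rewrite /B /X; nia.
  move=> h h' /=; rewrite !inordK; lia.
Qed.

(** * Majorant norm and interpolation at approximate zeros *)

Section MajorantNorm.
Variables (C : numFieldType) (R : C).
Hypothesis R_ge0 : 0 <= R.

(* The weighted l^1 norm sum_i |p_i| R^i, which is submultiplicative and bounds p on the
   disk of radius R. *)
Definition nrm (p : {poly C}) : C := (map_poly Num.norm p).[R].

Lemma nrmE n (p : {poly C}) : (size p <= n)%N -> nrm p = \sum_(i < n) `|p`_i| * R ^+ i.
Proof.
move=> p_n; rewrite /nrm (@horner_coef_wide _ n); last first.
  by apply: leq_trans (size_poly _ _) p_n.
by apply: eq_bigr => i _; rewrite coef_map_id0 ?normr0.
Qed.

Lemma nrm_ge0 p : 0 <= nrm p.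
Proof.
rewrite (nrmE (leqnn _)); apply: sumr_ge0 => i _.
by rewrite mulr_ge0 ?exprn_ge0.
Qed.

Lemma nrm0 : nrm 0 = 0.
Proof. by rewrite (@nrmE 0) ?size_poly0 ?big_ord0. Qed.

Lemma nrmD p q : nrm (p + q) <= nrm p + nrm q.
Proof.
rewrite (nrmE (size_polyD p q)) (nrmE (leq_maxl (size p) (size q))).
rewrite (nrmE (leq_maxr (size p) (size q))) -big_split /=.
apply: ler_sum => i _; rewrite -mulrDl coefD ler_wpM2r ?exprn_ge0 //.
exact: ler_normD.
Qed.

Lemma nrmZ a p : nrm (a *: p) = `|a| * nrm p.
Proof.
rewrite (nrmE (size_scale_leq a p)) (nrmE (leqnn _)) mulr_sumr.
by apply: eq_bigr => i _; rewrite coefZ normrM mulrA.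
Qed.

Lemma nrm_MXaddC p c : nrm (p * 'X + c%:P) = nrm p * R + `|c|.
Proof.
rewrite (@nrmE (size p).+1); last first.
  by rewrite size_MXaddC; case: ifP.
rewrite big_ord_recl (nrmE (leqnn _)) mulr_suml addrC expr0 mulr1.
rewrite coefD coefMX coefC add0r; congr (_ + _).
by apply: eq_bigr => i _; rewrite coefD coefMX coefC /= addr0 exprSr mulrA.
Qed.

Lemma nrmC c : nrm c%:P = `|c|.
Proof. by rewrite -[c%:P]add0r -(mul0r 'X) nrm_MXaddC nrm0 mul0r add0r. Qed.

Lemma nrmX : nrm 'X = R.
Proof. by rewrite -['X]mul1r -[_ * _]addr0 nrm_MXaddC nrmC normr1 normr0 mul1r addr0. Qed.

Lemma nrm_sum (I : finType) (F : I -> {poly C}) :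
  nrm (\sum_i F i) <= \sum_i nrm (F i).
Proof.
elim/big_rec2: _ => [|i x p _ IH]; first by rewrite nrm0.
by apply: le_trans (nrmD _ _) _; rewrite lerD2l.
Qed.

Lemma nrmM p q : nrm (p * q) <= nrm p * nrm q.
Proof.
elim/poly_ind: p => [|p c IH]; first by rewrite mul0r nrm0 mul0r.
have -> : (p * 'X + c%:P) * q = (p * q * 'X + 0%:P) + c *: q.
  by rewrite mulrDl addr0 -mul_polyC -!mulrA ['X * q]mulrC.
apply: le_trans (nrmD _ _) _.
rewrite !nrm_MXaddC nrmZ normr0 addr0 mulrDl lerD2r mulrAC.
by rewrite ler_wpM2r.
Qed.

Lemma nrm_exp p n : nrm (p ^+ n) <= nrm p ^+ n.
Proof.
elim: n => [|n IH]; first by rewrite !expr0 -[1]/(1%:P) nrmC normr1.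
rewrite !exprS; apply: le_trans (nrmM _ _) _.
by rewrite ler_wpM2l ?nrm_ge0.
Qed.

Lemma horner_le_nrm p z : `|z| <= R -> `|p.[z]| <= nrm p.
Proof.
move=> zR; elim/poly_ind: p => [|p c IH]; first by rewrite horner0 nrm0 normr0.
rewrite hornerMXaddC nrm_MXaddC; apply: le_trans (ler_normD _ _) _.
by rewrite lerD2r normrM ler_pM.
Qed.

(** Synthetic division by X - z: for p X + c the quotient is p + z q, and the estimate survives
    because nrm p (R - rho) + rho nrm p = nrm p R. It plays the part of the maximum principle. *)
Lemma nrm_divided_difference (rho z : C) (p : {poly C}) :
  `|z| <= rho -> rho < R ->
  exists2 q, p = p.[z]%:P + ('X - z%:P) * q & nrm q * (R - rho) <= nrm p.
Proof.
move=> zrho rhoR; elim/poly_ind: p => [|p c [q pE qp]].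
  by exists 0; rewrite ?nrm0 ?horner0 ?mul0r // mulr0 addr0.
have rho_ge0 : 0 <= rho by apply: le_trans zrho.
exists (p + z *: q).
  rewrite hornerMXaddC [in LHS]pE [in RHS]pE !hornerE subrr mul0r addr0.
  rewrite polyCD polyCM -!mul_polyC; ring.
rewrite nrm_MXaddC; apply: le_trans (_ : nrm p * R <= _); last by rewrite lerDl.
apply: le_trans (_ : (nrm p + rho * nrm q) * (R - rho) <= _).
  rewrite ler_wpM2r //; first by rewrite subr_ge0 ltW.
  apply: le_trans (nrmD _ _) _; rewrite lerD2l nrmZ ler_wpM2r ?nrm_ge0 //.
have -> : nrm p * R = nrm p * (R - rho) + rho * nrm p by ring.
by rewrite mulrDl -mulrA lerD2l ler_wpM2l.
Qed.

(** A Schwarz lemma by repeated division. Removing z leaves a quotient q with |q(x)| <= 2 eta at the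
    other points, which are at distance at least 1 from z; then |p(w)| <= eta + D |q(w)|, and each
    division multiplies the norm term by D / (R - rho). *)
Lemma approx_zeros_bound (rho D eta w : C) (s : seq C) (p : {poly C}) :
  rho < R -> 0 <= eta -> `|w| <= R ->
  pairwise (fun x y => 1 <= `|x - y|) s ->
  (forall z, z \in s -> `|z| <= rho) ->
  (forall z, z \in s -> `|w - z| <= D) ->
  (forall z, z \in s -> `|p.[z]| <= eta) ->
  `|p.[w]| <= eta * (1 + 2 * D) ^+ size s + nrm p * (D / (R - rho)) ^+ size s.
Proof.
move=> rhoR eta_ge0 wR; have Rrho : 0 < R - rho by rewrite subr_gt0.
elim: s p eta eta_ge0 => [|z s IH] p eta eta_ge0 /=.
  by move=> *; rewrite !expr0 !mulr1 ler_wpDl // horner_le_nrm.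
move=> /andP [/allP zs s_sep] s_rho s_D s_eta.
have zz : z \in z :: s by rewrite mem_head.
have sz x : x \in s -> x \in z :: s by rewrite inE => ->; rewrite orbT.
have [q pE qp] := nrm_divided_difference p (s_rho z zz) rhoR.
have D_ge0 : 0 <= D by apply: le_trans (s_D z zz).
have {}IH : `|q.[w]| <= (2 * eta) * (1 + 2 * D) ^+ size s
      + nrm q * (D / (R - rho)) ^+ size s.
  have eta2_ge0 : 0 <= 2 * eta by rewrite mulr_ge0.
  apply: IH => //.
  - by move=> x /sz /s_rho.
  - by move=> x /sz /s_D.
  - move=> x xs; have zx := zs _ xs.
    have -> : q.[x] = (p.[x] - p.[z]) / (x - z).
      have xz : x - z != 0 by rewrite -normr_gt0 distrC (lt_le_trans _ zx).
      by rewrite [p in p.[x]]pE !hornerE; field.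
    rewrite distrC in zx; have zx0 : 0 < `|x - z| by apply: lt_le_trans zx.
    rewrite normrM normfV ler_pdivrMr //.
    apply: le_trans (ler_normB _ _) _.
    apply: le_trans (_ : 2 * eta <= _).
      by rewrite mulr_natl mulr2n lerD // s_eta // sz.
    by rewrite ler_peMr // mulr_ge0.
rewrite [p in p.[w]]pE !hornerE; apply: le_trans (ler_normD _ _) _.
set A := (1 + 2 * D) ^+ size s in IH *.
set B := (D / (R - rho)) ^+ size s in IH *.
have A_ge1 : 1 <= A by rewrite exprn_ege1 // lerDl mulr_ge0.
have B_ge0 : 0 <= B by rewrite exprn_ge0 // divr_ge0 // ltW.
apply: le_trans (_ : eta * A + D * (2 * eta * A + nrm q * B) <= _).
  apply: lerD; first by apply: le_trans (s_eta z zz) _; rewrite ler_peMr.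
  by rewrite normrM ler_pM ?s_D.
rewrite /= !exprS -/A -/B.
have -> : eta * A + D * (2 * eta * A + nrm q * B)
        = eta * ((1 + 2 * D) * A) + nrm q * (D * B) by ring.
rewrite lerD2l.
have -> : nrm q * (D * B) = (nrm q * (R - rho)) * (D / (R - rho) * B).
  by field; rewrite gt_eqF.
by rewrite ler_wpM2r // mulr_ge0 // divr_ge0 // ltW.
Qed.

End MajorantNorm.

Lemma coefs_eq0 (F : fieldType) n (c x : 'I_n -> F) :
  injective x -> (forall i, \sum_j c j * x i ^+ j = 0) -> forall j, c j = 0.
Proof.
move=> x_inj cx j; pose p := \sum_j c j *: 'X^j : {poly F}.
have coefp j' : p`_(j' : 'I_n) = c j'.
  rewrite coef_sum (bigD1 j') //= coefZ coefXn eqxx mulr1 big1 ?addr0 //.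
  by move=> i ij; rewrite coefZ coefXn eq_sym (negPf (ij : (i : nat) != j')) mulr0.
have size_p : (size p <= n)%N.
  apply: leq_trans (size_sum _ _ _) _; apply/bigmax_leqP => i _.
  by apply: leq_trans (size_scale_leq _ _) _; rewrite size_polyXn.
have [p0|p0] := eqVneq p 0; first by rewrite -coefp p0 coef0.
suff : (size [seq x i | i <- enum 'I_n] < size p)%N.
  by rewrite size_map size_enum_ord ltnNge size_p.
apply: max_poly_roots => //; last by rewrite map_inj_uniq // enum_uniq.
apply/allP => _ /mapP [i _ ->]; rewrite /root horner_sum.
by rewrite -[X in _ == X](cx i); apply/eqP/eq_bigr => k _; rewrite hornerZ hornerXn.
Qed.

(** * Gaussian integers and exponential polynomials on a grid *)

Section Grid.
Variable C : numClosedFieldType.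

Definition gaussp (a b : nat) : C := a%:R + 'i * b%:R.

Lemma gaussp_sub_ge1 a b a' b' :
  (a, b) != (a', b') -> 1 <= `|gaussp a b - gaussp a' b'|.
Proof.
move=> neq.
have -> : gaussp a b - gaussp a' b' =
   (a%:Z - a'%:Z)%:~R + 'i * (b%:Z - b'%:Z)%:~R by rewrite /gaussp !intrB; ring.
rewrite -(@expr_ge1 _ 2) // normC2_rect ?realz // -!rmorphXn -intrD ler1z.
suff : 0 < (a%:Z - a'%:Z) ^+ 2 + (b%:Z - b'%:Z) ^+ 2 by lia.
have [aa'|aa'] := eqVneq a a'; have [bb'|bb'] := eqVneq b b'; try nia.
by rewrite aa' bb' eqxx in neq.
Qed.

Lemma norm_gaussp a b : `|gaussp a b| <= a%:R + b%:R.
Proof.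
by apply: le_trans (ler_normD _ _) _; rewrite normrM normCi mul1r !normr_nat.
Qed.

Lemma gaussp_dist a b a' b' n :
  (a <= n)%N -> (b <= n)%N -> (a' <= n)%N -> (b' <= n)%N ->
  `|gaussp a b - gaussp a' b'| <= (2 * n)%:R.
Proof.
move=> an bn an' bn'.
have dist (x y : nat) : (x <= n)%N -> (y <= n)%N -> `|x%:R - y%:R| <= n%:R :> C.
  move=> xn yn; rewrite -[x%:R]/(x%:Z%:~R) -[y%:R]/(y%:Z%:~R) -intrB -intr_norm.
  by rewrite -[n%:R]/(n%:Z%:~R) ler_int; lia.
have -> : gaussp a b - gaussp a' b' = (a%:R - a'%:R) + 'i * (b%:R - b'%:R).
  by rewrite /gaussp; ring.
apply: le_trans (ler_normD _ _) _.
by rewrite normrM normCi mul1r mulSn mul1n natrD lerD ?dist.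
Qed.

(** Real and imaginary parts of (a + ib)^j over Z, so that vanishing at a grid point becomes two
    integer linear conditions for [siegel]. *)
Fixpoint gpow (a b j : nat) : int * int :=
  if j is j'.+1 then
    let: (u, v) := gpow a b j' in (a%:Z * u - b%:Z * v, a%:Z * v + b%:Z * u)
  else (1, 0).

Lemma gpowE a b j :
  gaussp a b ^+ j = (gpow a b j).1%:~R + 'i * (gpow a b j).2%:~R.
Proof.
elim: j => [|j IH]; first by rewrite expr0 mulr0 addr0.
rewrite exprS IH /=; case: (gpow a b j) => u v /=.
rewrite /gaussp intrB intrD !intrM -!pmulrn.
have ii : 'i * 'i = -1 :> C by rewrite -expr2 sqrCi.
transitivity (a%:R * u%:~R + 'i * 'i * (b%:R * v%:~R)
   + 'i * (a%:R * v%:~R + b%:R * u%:~R) : C); first by ring.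
by rewrite ii; ring.
Qed.

Lemma gpow_le a b j :
  `|(gpow a b j).1| + `|(gpow a b j).2| <= ((a + b) ^ j)%:Z.
Proof.
elim: j => [|j IH] //=; case: (gpow a b j) IH => u v /=; rewrite expnS PoszM => IH.
apply: le_trans (_ : (a + b)%:Z * (`|u| + `|v|) <= _); last by rewrite ler_wpM2l.
apply: le_trans (_ : (a%:Z * `|u| + b%:Z * `|v|) + (a%:Z * `|v| + b%:Z * `|u|) <= _).
  by apply: lerD; [apply: le_trans (ler_normB _ _) _ | apply: le_trans (ler_normD _ _) _];
     rewrite !normrM.
by rewrite PoszD [leRHS]mulrDl !mulrDr; lia.
Qed.

Definition gaussint (x : C) := exists u v : int, x = u%:~R + 'i * v%:~R.

Lemma gaussint_int (u : int) : gaussint u%:~R.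
Proof. by exists u, 0; rewrite mulr0 addr0. Qed.

Lemma gaussintD x y : gaussint x -> gaussint y -> gaussint (x + y).
Proof.
move=> [u [v ->]] [u' [v' ->]]; exists (u + u'), (v + v').
by rewrite !intrD; ring.
Qed.

Lemma gaussintM (m : int) x : gaussint x -> gaussint (m%:~R * x).
Proof. by move=> [u [v ->]]; exists (m * u), (m * v); rewrite !intrM; ring. Qed.

Lemma gaussint_sum (I : finType) (F : I -> C) :
  (forall i, gaussint (F i)) -> gaussint (\sum_i F i).
Proof.
by move=> FP; apply: big_ind => //; [exact: (gaussint_int 0) | exact: gaussintD].
Qed.

Lemma gaussint_exp a b j : gaussint (gaussp a b ^+ j).
Proof. by rewrite gpowE; exists (gpow a b j).1, (gpow a b j).2. Qed.

Lemma gaussint_eq0 x : gaussint x -> `|x| < 1 -> x = 0.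
Proof.
move=> [u [v ->]]; rewrite -(@expr_lt1 _ 2) // normC2_rect ?realz //.
rewrite -!rmorphXn -intrD ltrz1 => uv.
have -> : u = 0 by nia.
have -> : v = 0 by nia.
by rewrite mulr0 addr0.
Qed.

(** Two Vandermonde arguments: for fixed a, the J points a + ib kill each coefficient of the
    polynomial in z; these coefficients are polynomials in Y with K distinct roots r^a. *)
Lemma exp_poly_grid_eq0 J K (c : 'I_J -> 'I_K -> C) (r : C) :
  0 < r -> r < 1 ->
  (forall a b, (a < K)%N -> (b < J)%N ->
     \sum_j \sum_k c j k * gaussp a b ^+ j * (r ^+ a) ^+ k = 0) ->
  forall j k, c j k = 0.
Proof.
move=> r_gt0 r_lt1 cP j.
apply: (@coefs_eq0 _ _ _ (fun a : 'I_K => r ^+ a)) => [a a' /= raa'|a].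
  apply/val_inj/eqP; move: raa' => /=.
  case: (ltngtP a a') => // lt_a raa'.
    by have := ltr_iXn2l r_gt0 r_lt1 a' a; rewrite raa' ltxx lt_a.
  by have := ltr_iXn2l r_gt0 r_lt1 a a'; rewrite raa' ltxx lt_a.
apply: (@coefs_eq0 _ _ (fun j => \sum_k c j k * (r ^+ a) ^+ k)
           (fun b : 'I_J => gaussp a b)) => [b b' /eqP|b].
  apply: contraTeq => bb'; rewrite -subr_eq0 -normr_gt0.
  apply: lt_le_trans ltr01 (gaussp_sub_ge1 _).
  by rewrite xpair_eqE eqxx.
rewrite -[RHS](cP a b) //; apply: eq_bigr => j' _; rewrite mulr_suml.
by apply: eq_bigr => k _; rewrite mulrAC.
Qed.

End Grid.

Lemma exprB_le (F : numDomainType) (rho x y d : F) k :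
  1 <= rho -> `|x| <= rho -> `|y| <= rho -> `|x - y| <= d ->
  `|x ^+ k - y ^+ k| <= k%:R * rho ^+ k * d.
Proof.
move=> rho1 xr yr xy; have d_ge0 : 0 <= d by apply: le_trans xy.
have rho_ge0 : 0 <= rho by apply: le_trans rho1.
elim: k => [|k IH]; first by rewrite subrr normr0 !mul0r.
have -> : x ^+ k.+1 - y ^+ k.+1 = x * (x ^+ k - y ^+ k) + (x - y) * y ^+ k.
  by rewrite !exprS; ring.
apply: le_trans (ler_normD _ _) _; rewrite !normrM normrX.
apply: le_trans (_ : rho * (k%:R * rho ^+ k * d) + d * rho ^+ k <= _).
  by apply: lerD; apply: ler_pM => //; rewrite ?exprn_ge0 ?lerXn2r ?nnegrE.
rewrite exprS -[k.+1%:R]natr1.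
have -> : (k%:R + 1) * (rho * rho ^+ k) * d
   = rho * (k%:R * rho ^+ k * d) + rho * (d * rho ^+ k) by ring.
by rewrite lerD2l ler_peMl // mulr_ge0 // exprn_ge0.
Qed.

(** * The auxiliary polynomial P(z, Y) *)

Section Extrapolation.
Variable C : numClosedFieldType.

Definition bipoly J K (c : 'I_J -> 'I_K -> int) (z y : C) : C :=
  \sum_j \sum_k (c j k)%:~R * z ^+ j * y ^+ k.

(** [siegel] with 4 N^2 unknowns and 2 N^2 equations, a real and an imaginary one per grid point.
    Multiplying by q^(N K) clears the denominators and leaves integer entries of size at most (2N)^J
    q^(N K). *)
Lemma auxiliary_bipoly (N J K p q : nat) :
  (0 < N)%N -> (J * K = 4 * (N * N))%N -> (p <= q)%N -> (0 < q)%N ->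
  exists c : 'I_J -> 'I_K -> int,
    [/\ exists j k, c j k != 0,
        forall j k, `|c j k| <= (2 * (J * K) * ((2 * N) ^ J * q ^ (N * K)))%:Z
      & forall a b, (a < N)%N -> (b < N)%N ->
          bipoly c (gaussp C a b) ((p%:R / q%:R) ^+ a) = 0].
Proof.
move=> N_gt0 JK pq q_gt0; set U := ((2 * N) ^ J * q ^ (N * K))%N.
pose A (i : 'I_N * 'I_N * bool) (jk : 'I_J * 'I_K) : int :=
  (if i.2 then (gpow i.1.1 i.1.2 jk.1).1 else (gpow i.1.1 i.1.2 jk.1).2)
  * (p ^ (i.1.1 * jk.2) * q ^ (N * K - i.1.1 * jk.2))%:Z.
have aK (a : 'I_N) (k : 'I_K) : (a * k <= N * K)%N.
  by rewrite leq_mul // ltnW.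
have [||||c [c_neq0 c_le Ac]] := @siegel _ _ U A.
- by rewrite !card_prod !card_ord card_bool !muln_gt0 N_gt0.
- by rewrite /U muln_gt0 !expn_gt0 q_gt0 muln_gt0 N_gt0.
- by rewrite !card_prod !card_ord card_bool JK; lia.
- move=> [[a b] e] [j k]; rewrite /A /U normrM [leRHS]PoszM /=; apply: ler_pM => //.
    apply: le_trans (_ : ((a + b) ^ j)%:Z <= _).
      have := gpow_le a b j; case: (gpow a b j) => u v /=; case: e; lia.
    rewrite lez_nat; apply: leq_trans (_ : (2 * N) ^ j <= _)%N.
      by case: (nat_of_ord j) => // j'; rewrite leq_exp2r //; have := ltn_ord a; have := ltn_ord b; lia.
    by rewrite leq_pexp2l ?muln_gt0 ?N_gt0 // ltnW.
  rewrite ger0_norm // lez_nat -[in leqRHS](subnKC (aK a k)) expnD leq_mul //.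
  by case: (a * k)%N => // l; rewrite leq_exp2r.
exists (fun j k => c (j, k)); split.
- by have [[j k] cjk] := c_neq0; exists j, k.
- by move=> j k; have := c_le (j, k); rewrite card_prod !card_ord.
move=> a b aN bN; have q_neq0 : q%:R != 0 :> C by rewrite pnatr_eq0 -lt0n.
apply: (mulfI (_ : q%:R ^+ (N * K) != 0)); first by rewrite expf_neq0.
rewrite mulr0 /bipoly pair_bigA mulr_sumr /=.
transitivity (\sum_jk (A (Ordinal aN, Ordinal bN, true) jk * c jk)%:~R
   + 'i * \sum_jk (A (Ordinal aN, Ordinal bN, false) jk * c jk)%:~R : C).
  rewrite mulr_sumr -big_split /=; apply: eq_bigr => -[j k] _.
  rewrite /A /= gpowE !intrM; case: (gpow a b j) => u v /=.
  have ak := aK (Ordinal aN) k; rewrite /= in ak.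
  rewrite -pmulrn natrM !natrX -exprM expr_div_n.
  rewrite -[in LHS](subnKC ak) exprD; field.
  by rewrite expf_neq0.
by rewrite -!(rmorph_sum (intr : {rmorphism int -> C})) !Ac mulr0 addr0.
Qed.

Section Step.
Variables (J K X : nat) (c : 'I_J -> 'I_K -> int).
Hypothesis c_le : forall j k, `|c j k| <= X%:Z.

Lemma coef_le j k : `|(c j k)%:~R : C| <= X%:R.
Proof. by rewrite -intr_norm -[X%:R]/(X%:Z%:~R) ler_int. Qed.

Lemma sum_le (F : 'I_J -> 'I_K -> C) (B : C) :
  (forall j k, F j k <= B) -> \sum_j \sum_k F j k <= (J * K)%:R * B.
Proof.
move=> FB; rewrite pair_bigA /=.
apply: le_trans (ler_sum (G := fun=> B) _ _) _; first by move=> [j k] _; apply: FB.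
by rewrite sumr_const card_prod !card_ord mulr_natl.
Qed.

(** P(z, g(z)), where the polynomial [g] stands in for exp(-2 pi m z). *)
Definition compose_poly (g : {poly C}) : {poly C} :=
  \sum_j \sum_k (c j k)%:~R *: ('X^j * g ^+ k).

Lemma horner_compose_poly g z : (compose_poly g).[z] = bipoly c z g.[z].
Proof.
rewrite /compose_poly /bipoly horner_sum; apply: eq_bigr => j _.
rewrite horner_sum; apply: eq_bigr => k _.
by rewrite hornerZ hornerM hornerXn horner_exp mulrA.
Qed.

Lemma nrm_compose_poly (R E : nat) g :
  (0 < R)%N -> (0 < E)%N -> nrm R%:R g <= E%:R ->
  nrm R%:R (compose_poly g) <= (J * K * X * R ^ J * E ^ K)%:R.
Proof.
move=> R_gt0 E_gt0 gE; apply: le_trans (nrm_sum _ _) _ => //.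
apply: le_trans (_ : \sum_j \sum_k nrm R%:R ((c j k)%:~R *: ('X^j * g ^+ k)) <= _).
  by apply: ler_sum => j _; apply: nrm_sum.
rewrite -!mulnA [(J * _)%N]mulnA natrM; apply: sum_le => j k.
rewrite nrmZ // natrM; apply: ler_pM; rewrite ?nrm_ge0 // ?coef_le //.
apply: le_trans (nrmM _ _ _) _ => //; rewrite natrM; apply: ler_pM; rewrite ?nrm_ge0 //.
  apply: le_trans (nrm_exp _ _ _) _ => //; rewrite nrmX // -natrX ler_nat.
  by rewrite leq_pexp2l // ltnW.
apply: le_trans (nrm_exp _ _ _) _ => //.
apply: le_trans (_ : E%:R ^+ k <= _); first by rewrite lerXn2r ?nnegrE ?nrm_ge0.
by rewrite -natrX ler_nat leq_pexp2l // ltnW.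
Qed.

(** Error of passing from P(z, r^a) to P(z, g(z)). The bound 2 on both values is enough, as r^a <= 1
    and g(z) will be within 1 of it. *)
Lemma bipolyB_le (B : nat) (z x y d : C) :
  (0 < B)%N -> `|z| <= B%:R -> `|x| <= 2 -> `|y| <= 2 -> `|x - y| <= d ->
  `|bipoly c z x - bipoly c z y| <= (J * K * X * B ^ J * K * 2 ^ K)%:R * d.
Proof.
move=> B_gt0 zB x2 y2 xy; have d_ge0 : 0 <= d by apply: le_trans xy.
rewrite /bipoly -sumrB; apply: le_trans (ler_norm_sum _ _ _) _.
apply: le_trans (_ : \sum_j \sum_k `|(c j k)%:~R * z ^+ j * (x ^+ k - y ^+ k)| <= _).
  apply: ler_sum => j _; rewrite -sumrB; apply: le_trans (ler_norm_sum _ _ _) _.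
  by apply: ler_sum => k _; rewrite mulrBr.
rewrite -!mulnA [(J * _)%N]mulnA natrM -mulrA; apply: sum_le => j k.
rewrite !normrM natrM -!mulrA; apply: ler_pM; rewrite ?mulr_ge0 ?coef_le //.
rewrite natrM -mulrA; apply: ler_pM; rewrite ?exprn_ge0 //.
  rewrite normrX; apply: le_trans (_ : B%:R ^+ j <= _).
    by rewrite lerXn2r ?nnegrE.
  by rewrite -natrX ler_nat leq_pexp2l // ltnW.
apply: le_trans (exprB_le _ (ler1n _ 2) x2 y2 xy) _.
rewrite ler_wpM2r // -natrX -natrM ler_nat.
by rewrite leq_mul ?leq_pexp2l // ltnW.
Qed.

End Step.
End Extrapolation.

(** * Extrapolation from grid to grid *)

Section Vanishing.
Variable C : numClosedFieldType.

Lemma gaussint_bipoly J K (c : 'I_J -> 'I_K -> int) (p q n a b : nat) :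
  (0 < q)%N -> (a <= n)%N ->
  gaussint (q%:R ^+ (n * K) * bipoly c (gaussp C a b) ((p%:R / q%:R) ^+ a)).
Proof.
move=> q_gt0 an; rewrite mulr_sumr; apply: gaussint_sum => j.
rewrite mulr_sumr; apply: gaussint_sum => k.
have q_neq0 : q%:R != 0 :> C by rewrite pnatr_eq0 -lt0n.
have ak : (a * k <= n * K)%N by rewrite leq_mul // ltnW.
have -> : q%:R ^+ (n * K)
    * ((c j k)%:~R * gaussp C a b ^+ j * ((p%:R / q%:R) ^+ a) ^+ k)
  = (c j k * (q ^ (n * K - a * k) * p ^ (a * k))%:Z)%:~R * gaussp C a b ^+ j.
  rewrite intrM -pmulrn natrM !natrX -exprM expr_div_n.
  rewrite -[in LHS](subnKC ak) exprD; field.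
  by rewrite expf_neq0.
exact/gaussintM/gaussint_exp.
Qed.

Definition grid n : seq C :=
  [seq gaussp C (val ab.1) (val ab.2) | ab <- enum {: 'I_n * 'I_n}].

Lemma size_grid n : size (grid n) = (n * n)%N.
Proof. by rewrite size_map -cardE card_prod !card_ord. Qed.

Lemma mem_grid n z : z \in grid n ->
  exists a b, [/\ (a < n)%N, (b < n)%N & z = gaussp C a b].
Proof. by move=> /mapP [[a b] _ ->]; exists a, b; rewrite !ltn_ord. Qed.

Lemma pairwise_grid n : pairwise (fun x y => 1 <= `|x - y|) (grid n).
Proof.
rewrite pairwise_map; have := enum_uniq {: 'I_n * 'I_n}.
rewrite uniq_pairwise; apply: sub_pairwise => -[a b] [a' b'] /= neq.
by apply: gaussp_sub_ge1; apply: contra neq; rewrite !xpair_eqE.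
Qed.

(** One extrapolation step. P(z, g(z)) is nearly zero on the n by n grid, so [approx_zeros_bound]
    with rho = D = 2n and R = 6n makes it small at the new points; there q^(n K) P(z, r^a) is a
    Gaussian integer of modulus below 1. The condition with 2^S absorbs the error of [g], the one
    with 2^(n n) the norm of P(z, g(z)). *)
Lemma vanish_succ J K X (c : 'I_J -> 'I_K -> int) (p q S n E : nat) (g : {poly C}) :
  (forall j k, `|c j k| <= X%:Z) ->
  (0 < n)%N -> (0 < q)%N -> (p <= q)%N -> (0 < E)%N ->
  (forall a b, (a <= n)%N -> (b <= n)%N ->
     `|g.[gaussp C a b] - (p%:R / q%:R) ^+ a| <= (2 ^+ S)^-1) ->
  nrm (6 * n)%:R g <= E%:R ->
  (4 * (q ^ (n * K) * (J * K * X * (2 * n) ^ J * K * 2 ^ K) * (1 + 4 * n) ^ (n * n))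
     <= 2 ^ S)%N ->
  (4 * (q ^ (n * K) * (J * K * X * (6 * n) ^ J * E ^ K)) <= 2 ^ (n * n))%N ->
  (forall a b, (a < n)%N -> (b < n)%N ->
     bipoly c (gaussp C a b) ((p%:R / q%:R) ^+ a) = 0) ->
  forall a b, (a <= n)%N -> (b <= n)%N ->
     bipoly c (gaussp C a b) ((p%:R / q%:R) ^+ a) = 0.
Proof.
move=> c_le n_gt0 q_gt0 pq E_gt0 g_approx gE leS leN vanish a b an bn.
set r : C := p%:R / q%:R in g_approx vanish *.
have q_gt0R : 0 < q%:R :> C by rewrite ltr0n.
have r_ge0 : 0 <= r by rewrite divr_ge0.
have r_le1 : r <= 1 by rewrite ler_pdivrMr // mul1r ler_nat.
have n_gt0R : 0 < n%:R :> C by rewrite ltr0n.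
have S_le1 : (2 ^+ S)^-1 <= 1 :> C.
  by rewrite invf_le1 ?exprn_gt0 // exprn_ege1 // ler1n.
set W := (J * K * X * (2 * n) ^ J * K * 2 ^ K)%N in leS.
set V := (J * K * X * (6 * n) ^ J * E ^ K)%N in leN.
pose eta : C := W%:R / 2 ^+ S.
have eta_ge0 : 0 <= eta by rewrite divr_ge0 // exprn_ge0.
have approx a' b' : (a' <= n)%N -> (b' <= n)%N ->
    `|(compose_poly c g).[gaussp C a' b'] - bipoly c (gaussp C a' b') (r ^+ a')|
    <= eta.
  move=> an' bn'; rewrite horner_compose_poly.
  have ra1 : `|r ^+ a'| <= 1 by rewrite normrX ger0_norm // exprn_ile1.
  apply: bipolyB_le => //; first by rewrite muln_gt0.
  - apply: le_trans (norm_gaussp _ _ _) _.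
    by rewrite -natrD ler_nat mul2n -addnn leq_add.
  - rewrite -[g.[_]](subrK (r ^+ a')); apply: le_trans (ler_normD _ _) _.
    rewrite -[2]/(1 + 1); apply: lerD => //.
    by apply: le_trans S_le1; apply: g_approx.
  - by apply: le_trans ra1 _; rewrite ler1n.
  - exact: g_approx.
have nrmF : nrm (6 * n)%:R (compose_poly c g) <= V%:R.
  by apply: nrm_compose_poly => //; rewrite muln_gt0.
have bound : `|(compose_poly c g).[gaussp C a b]|
    <= eta * (1 + 2 * (2 * n)%:R) ^+ size (grid n)
       + nrm (6 * n)%:R (compose_poly c g)
         * ((2 * n)%:R / ((6 * n)%:R - (2 * n)%:R)) ^+ size (grid n).
  apply: (@approx_zeros_bound _ _ _ (2 * n)%:R) => //.
  - by rewrite ltr_nat; lia.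
  - apply: le_trans (norm_gaussp _ _ _) _.
    by rewrite -natrD ler_nat; lia.
  - exact: pairwise_grid.
  - move=> _ /mem_grid [a' [b' [an' bn' ->]]].
    by apply: le_trans (norm_gaussp _ _ _) _; rewrite -natrD ler_nat; lia.
  - move=> _ /mem_grid [a' [b' [an' bn' ->]]].
    by apply: gaussp_dist => //; apply: ltnW.
  - move=> _ /mem_grid [a' [b' [an' bn' ->]]].
    by have := approx _ _ (ltnW an') (ltnW bn'); rewrite vanish // subr0.
rewrite size_grid in bound.
(* The radii 2n and 6n are chosen so that each of the n^2 approximate zeros gains a factor 1/2. *)
have half : (2 * n)%:R / ((6 * n)%:R - (2 * n)%:R) = 2^-1 :> C.
  have -> : (6 * n)%:R - (2 * n)%:R = 4 * n%:R :> C by rewrite !natrM; ring.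
  by rewrite natrM; field; rewrite gt_eqF.
rewrite half in bound.
have -> : bipoly c (gaussp C a b) (r ^+ a)
    = (q%:R ^+ (n * K))^-1 * (q%:R ^+ (n * K) * bipoly c (gaussp C a b) (r ^+ a)).
  by rewrite mulrA mulVf ?mul1r // expf_neq0 // gt_eqF.
rewrite (@gaussint_eq0 C (q%:R ^+ (n * K) * _)) ?mulr0 //.
  exact: gaussint_bipoly.
set Q : C := q%:R ^+ (n * K).
have Q_ge0 : 0 <= Q by rewrite exprn_ge0.
set M : C := (1 + 2 * (2 * n)%:R) ^+ (n * n) in bound.
have M_ge1 : 1 <= M by rewrite exprn_ege1 // lerDl mulr_ge0.
have leS' : 4 * (Q * W%:R * M) <= 2 ^+ S.
  move: leS; rewrite -(ler_nat C) !natrM !natrX natrD natrM /M /Q.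
  by rewrite (_ : 2 * (2 * n)%:R = 4 * n%:R) // natrM mulrA -natrM.
have leN' : 4 * (Q * V%:R) <= 2 ^+ (n * n).
  by move: leN; rewrite -(ler_nat C) !natrM !natrX.
have QM : Q * (eta * M) <= 4^-1.
  rewrite /eta (_ : Q * _ = (Q * W%:R * M) / 2 ^+ S); last by ring.
  by rewrite ler_pdivrMr ?exprn_gt0 // ler_pdivlMl.
have Qe : Q * eta <= 4^-1.
  by apply: le_trans QM; rewrite ler_wpM2l // ler_peMr.
have QV : Q * (V%:R * 2^-1 ^+ (n * n)) <= 4^-1.
  rewrite exprVn mulrA.
  by rewrite ler_pdivrMr ?exprn_gt0 // ler_pdivlMl.
rewrite normrM (ger0_norm Q_ge0).
(* A quarter each for the error of [g] at the new point, the error propagated from the old grid, and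
   the norm after n^2 halvings. *)
apply: le_lt_trans (_ : 4^-1 + 4^-1 + 4^-1 < 1); last first.
  have -> : 4^-1 + 4^-1 + 4^-1 = 3 / 4 :> C by field.
  by rewrite ltr_pdivrMr // mul1r ltr_nat.
apply: le_trans (_ : Q * (eta + (eta * M + V%:R * 2^-1 ^+ (n * n))) <= _).
  rewrite ler_wpM2l //.
  rewrite -[bipoly _ _ _](subKr ((compose_poly c g).[gaussp C a b])).
  apply: le_trans (ler_normB _ _) _; rewrite addrC; apply: lerD.
    exact: approx.
  by apply: le_trans bound _; rewrite lerD2l ler_wpM2r // exprn_ge0 // invr_ge0.
by rewrite !mulrDr addrA; apply: lerD => //; apply: lerD.
Qed.

Lemma leq_mul_exp2 a b x y : (a <= 2 ^ x -> b <= 2 ^ y -> a * b <= 2 ^ (x + y))%N.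
Proof. by move=> *; rewrite expnD leq_mul. Qed.

Lemma leq_exp_exp2 a k x : (a <= 2 ^ x -> a ^ k <= 2 ^ (x * k))%N.
Proof. by move=> ?; rewrite expnM; case: k => // k; rewrite leq_exp2r. Qed.

(** The 2^S condition of [vanish_succ] in base 2 logarithms, with u = T^3. The main term is s n^2 <=
    16 s u^2, from (1 + 4n)^(n n); the rest fits into 4 s u^2. *)
Lemma exponent_approx (s T u n : nat) :
  (0 < s)%N -> T = (20 * s)%N -> (400 * T <= u)%N -> (n <= 4 * u)%N ->
  (2 + (s * (n * T) + (s + s + (1 + (s + s) + (s * (4 * u) + s * u)) + s * (4 * u)
    + s + T) + s * (n * n)) <= 20 * s * (u * u))%N.
Proof.
move=> s_gt0 Ts Tu nu.
have h1 : (n * T <= 4 * u * T)%N by rewrite leq_mul2r nu orbT.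
have h2 : (400 * T * u <= u * u)%N by rewrite leq_mul2r Tu orbT.
have h3 : (n * n <= 16 * (u * u))%N by nia.
have h4 : (400 * u <= u * u)%N by rewrite leq_mul2r; lia.
have -> : (20 * s * (u * u) = s * (20 * (u * u)))%N by lia.
apply: leq_trans (_ : s * (n * T + 9 * u + n * n + 28) <= _)%N; first by lia.
by rewrite leq_mul2l; lia.
Qed.

(** The 2^(n n) condition in base 2 logarithms. As s = T / 20 and T^2 <= n, each term s n T is at
    most n^2 / 20; T u <= n^2 bounds s u in the same way. *)
Lemma exponent_schwarz (s T u n : nat) :
  (0 < s)%N -> T = (20 * s)%N -> (T * T <= n)%N -> (T * u <= n * n)%N ->
  (2 + (s * (n * T) + (s + s + (1 + (s + s) + (s * (4 * u) + s * u)) + s * (4 * u)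
    + s * n * T)) <= n * n)%N.
Proof.
move=> s_gt0 Ts Tn Tu.
have h1 : (20 * (s * (n * T)) <= n * n)%N.
  have -> : (20 * (s * (n * T)) = n * (T * T))%N by rewrite {3}Ts; lia.
  by rewrite leq_mul2l Tn orbT.
have h2 : (20 * (s * u) <= n * n)%N by move: Tu; rewrite {1}Ts; lia.
have h3 : (400 * s <= n)%N by nia.
have h4 : (400 * n <= n * n)%N by rewrite leq_mul2r; lia.
lia.
Qed.

(* P has T powers of Y and J = 4 T^3 powers of z, and starts by vanishing on the T^2 by
   T^2 grid: half as many linear conditions over Z as coefficients. *)
Lemma no_approximation (s p q : nat) (g : {poly C}) :
  let T := (20 * s)%N in let J := (4 * T ^ 3)%N in let S := (20 * s * T ^ 6)%N in
  (0 < s)%N -> (24 * T ^ 3 <= 2 ^ s)%N -> (0 < p)%N -> (p < q)%N -> (q <= 2 ^ s)%N ->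
  (forall n, nrm (6 * n)%:R g <= (2 ^ (s * n))%:R) ->
  (forall a b, (a <= J)%N -> (b <= J)%N ->
     `|g.[gaussp C a b] - (p%:R / q%:R) ^+ a| <= (2 ^+ S)^-1) ->
  False.
Proof.
move=> T J S s_gt0 T_le p_gt0 pq q_le gE g_approx.
have T_gt0 : (0 < T)%N by rewrite muln_gt0.
have q_gt0 : (0 < q)%N by apply: leq_trans pq.
have [||||c [c_neq0 c_le c0]] := @auxiliary_bipoly C (T ^ 2) J T p q.
- by rewrite expn_gt0 T_gt0.
- by rewrite /J -expnD -mulnA -expnSr.
- exact: ltnW.
- by [].
set X := (2 * _ * _)%N in c_le.
(* The zeros spread one grid size at a time, from T^2, where they hold by construction, up to J. *)
have vanish n : (T ^ 2 <= n)%N -> (n <= J)%N -> forall a b, (a < n)%N -> (b < n)%N ->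
    bipoly c (gaussp C a b) ((p%:R / q%:R) ^+ a) = 0.
  elim: n => [|n IH].
    by rewrite leqn0 expn_eq0 eqn0Ngt T_gt0.
  rewrite leq_eqVlt => /orP [/eqP <- _ //|].
  rewrite ltnS => Tn nJ a b an bn.
  have n_gt0 : (0 < n)%N by apply: leq_trans Tn; rewrite expn_gt0 T_gt0.
  have nJ' := ltnW nJ.
  have T_le400 : (400 * T <= T ^ 3)%N by rewrite expnSr leq_mul2r; nia.
  have T_le3 : (T <= T ^ 3)%N by rewrite -{1}(expn1 T) leq_pexp2l.
  have le_T : (T <= 2 ^ s)%N by lia.
  have le_J : (J <= 2 ^ s)%N by rewrite /J; lia.
  have le_2n : (2 * n <= 2 ^ s)%N by rewrite /J in nJ; lia.
  have le_6n : (6 * n <= 2 ^ s)%N by rewrite /J in nJ; lia.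
  have le_4n : (1 + 4 * n <= 2 ^ s)%N by rewrite /J in nJ; lia.
  have le_T2 : (2 * T ^ 2 <= 2 ^ s)%N.
    by apply: leq_trans T_le; rewrite (expnS T 2); nia.
  (* Every factor is bounded by a power of 2, so that the size conditions become inequalities
     between exponents. *)
  have le_X := leq_mul_exp2 (leq_mul_exp2 (leqnn (2 ^ 1)) (leq_mul_exp2 le_J le_T))
     (leq_mul_exp2 (leq_exp_exp2 J le_T2) (leq_exp_exp2 (T ^ 2 * T) q_le)).
  have le4 : (4 <= 2 ^ 2)%N by [].
  apply: (@vanish_succ J T X c p q S n (2 ^ (s * n)) g) => //.
  - exact: ltnW.
  - by rewrite expn_gt0.
  - by move=> a' b' an' bn'; apply: g_approx; apply: leq_trans nJ'.
  - apply: leq_trans (leq_mul_exp2 le4 (leq_mul_exp2 (leq_mul_exp2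
      (leq_exp_exp2 _ q_le) (leq_mul_exp2 (leq_mul_exp2 (leq_mul_exp2
      (leq_mul_exp2 (leq_mul_exp2 le_J le_T) le_X) (leq_exp_exp2 _ le_2n)) le_T)
      (leqnn _))) (leq_exp_exp2 _ le_4n))) _.
    rewrite leq_exp2l // /S /J -expnSr (expnM T 3 2 : T ^ 6 = _)%N.
    by apply: exponent_approx => //; apply: ltnW.
  - apply: leq_trans (leq_mul_exp2 le4 (leq_mul_exp2
      (leq_exp_exp2 _ q_le) (leq_mul_exp2 (leq_mul_exp2
      (leq_mul_exp2 (leq_mul_exp2 le_J le_T) le_X) (leq_exp_exp2 _ le_6n))
      (leq_exp_exp2 _ (leqnn _))))) _.
    rewrite leq_exp2l // /J -expnSr; apply: exponent_schwarz => //.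
    by apply: leq_trans (leq_mul Tn Tn); rewrite -expnS -expnD.
  - by move=> a' b'; apply: IH.
(* The J by J grid contains the T by J grid on which vanishing forces all coefficients to be 0. *)
have [j [k cjk]] := c_neq0; move/negP: cjk; apply.
have := @exp_poly_grid_eq0 C J T (fun j k => (c j k)%:~R) (p%:R / q%:R).
rewrite -(intr_eq0 C) => -> //.
- by rewrite divr_gt0 ?ltr0n.
- by rewrite ltr_pdivrMr ?ltr0n // mul1r ltr_nat.
- move=> a b aT bJ; apply: (vanish J) => //.
    by rewrite /J; nia.
  by apply: leq_trans aT _; rewrite /J; nia.
Qed.

End Vanishing.

End Gelfond.

(** * Rational approximations of exp(-2 pi m) *)

Module ExpRational.
Import all_boot all_order all_algebra Rstruct complex.
Import zify ring lra.
Import Order.TTheory GRing.Theory Num.Theory.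
Import Gelfond.
Set Implicit Arguments.
Unset Strict Implicit.
Unset Printing Implicit Defensive.
Local Open Scope ring_scope.

Local Open Scope complex_scope.

Definition cexp (u v : R) : R[i] := (exp u * cos v) +i* (exp u * sin v).

Lemma cexpD u v u' v' : cexp (u + u') (v + v') = cexp u v * cexp u' v'.
Proof.
rewrite /cexp -expRD sinD cosD; apply/eqP; rewrite eq_complex /=.
by apply/andP; split; apply/eqP; ring.
Qed.

Lemma cexpX u v n : cexp u v ^+ n = cexp (u *+ n) (v *+ n).
Proof.
elim: n => [|n IH]; last by rewrite exprS IH !mulrS cexpD.
by rewrite expr0 !mulr0n /cexp expR0 cos_0 sin_0 mulr1 mulr0.
Qed.

Lemma norm_cexp u v : `|cexp u v| = (exp u)%:C.
Proof.
rewrite normc_def /= !exprMn -mulrDr.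
have -> : cos v ^+ 2 + sin v ^+ 2 = 1.
  by rewrite addrC !expr2; exact: sin2_cos2.
rewrite mulr1 sqrtr_sqr ger0_norm //; apply/RleP; left; exact: exp_pos.
Qed.

Lemma norm_real_complex (x : R) : `|x%:C| = `|x|%:C.
Proof. by rewrite normc_def /= expr0n addr0 sqrtr_sqr. Qed.

Lemma normc_le (x y : R) : `|x +i* y| <= (`|x| + `|y|)%:C.
Proof.
rewrite [x +i* y]complexE /= rmorphD /=; apply: le_trans (ler_normD _ _) _.
by rewrite normrM !norm_real_complex normc_def /= expr0n add0r expr1n sqrtr1 mul1r.
Qed.

(** Write e^w as the M-th power of e^(w/M). One factor errs by at most 4 (B/M)^2, and [exprB_le]
    with rho = exp(B/M) multiplies this by M exp B. *)
Lemma one_plus_pow_cexp (x y : R) (M : nat) (B : R) :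
  `|x| + `|y| <= B -> (0 < M)%N -> 2 * B <= M%:R ->
  `|(1 + (x / M%:R) +i* (y / M%:R)) ^+ M - cexp x y|
  <= (4 * B ^+ 2 * exp B / M%:R)%:C.
Proof.
move=> xyB M_gt0 BM; set u := x / M%:R; set v := y / M%:R.
have M_gt0R : 0 < M%:R :> R by rewrite ltr0n.
have uE : `|u| = `|x| / M%:R by rewrite normrM normfV normr_nat.
have vE : `|v| = `|y| / M%:R by rewrite normrM normfV normr_nat.
have uvB : `|u| + `|v| <= B / M%:R by rewrite uE vE -mulrDl ler_pM2r ?invr_gt0.
have BM2 : B / M%:R <= 1 / 2 by rewrite ler_pdivrMr //; lra.
have [u0 v0] : 0 <= `|u| /\ 0 <= `|v| by [].
have -> : cexp x y = cexp u v ^+ M.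
  by rewrite cexpX -(mulr_natr u) -(mulr_natr v) !divfK // gt_eqF.
have expE : 1 + B / M%:R <= exp (B / M%:R) by apply/RleP/exp_ineq1_le.
have rho_ge1 : 1 <= exp (B / M%:R).
  by apply: le_trans expE; rewrite lerDl; apply: le_trans uvB; rewrite addr_ge0.
have diff : `|1 + u +i* v - cexp u v| <= (4 * (B / M%:R) ^+ 2)%:C.
  have -> : 1 + u +i* v - cexp u v = - ((exp u * cos v - 1 - u) +i* (exp u * sin v - v)).
    rewrite /cexp; apply/eqP; rewrite eq_complex /=.
    by apply/andP; split; apply/eqP; ring.
  rewrite normrN; apply: le_trans (normc_le _ _) _; rewrite lecR.
  apply: le_trans (_ : 4 * (`|u| + `|v|) ^+ 2 <= _).
    have uh : Rle (Rabs u) (Rdiv (IZR 1) (IZR 2)).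
      apply/RleP; rewrite RdivE; apply: le_trans BM2; apply: le_trans uvB.
      by rewrite lerDl.
    have vh : Rle (Rabs v) (Rdiv (IZR 1) (IZR 2)).
      apply/RleP; rewrite RdivE; apply: le_trans BM2; apply: le_trans uvB.
      by rewrite lerDr.
    have /RleP := exp_cos_sin_sub_linear u v uh vh.
    by rewrite RpowE (_ : IZR 4 = 4 :> R) // -(INRE 4) INR_IZR_INZ.
  by rewrite ler_pM2l // lerXn2r // nnegrE ?addr_ge0 // (le_trans _ uvB) ?addr_ge0.
have := @exprB_le _ (exp (B / M%:R))%:C (1 + u +i* v) (cexp u v) _ M _ _ _ diff.
rewrite -rmorphXn expRX -(mulr_natr (B / _)) divfK ?gt_eqF //= => H.
apply: le_trans (H _ _ _) _.
- by rewrite -[1]/(1%:C) lecR.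
- apply: le_trans (ler_normD _ _) _; rewrite normr1.
  apply: le_trans (lerD (lexx 1) (normc_le u v)) _.
  by rewrite -[1]/(1%:C) -rmorphD lecR; apply: le_trans expE; rewrite lerD2l.
- rewrite norm_cexp lecR; apply/RleP/exp_mono/RleP.
  by apply: le_trans (ler_norm u) _; apply: le_trans uvB; rewrite lerDl.
- rewrite -(rmorph_nat (real_complex R)) -!rmorphM lecR.
  by rewrite le_eqVlt; apply/orP; left; apply/eqP; field; rewrite gt_eqF.
Qed.

Lemma gausspE a b : gaussp (complex R) a b = a%:R +i* b%:R.
Proof.
rewrite [RHS]complexE /= !(rmorph_nat (real_complex R)) /gaussp.
by congr (_ + _ * _).
Qed.

Definition exp_approx (w : R) (M : nat) : {poly complex R} :=
  ((w / M%:R)%:C%:P * 'X + 1%:P) ^+ M.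

Lemma horner_exp_approx w M a b :
  (exp_approx w M).[gaussp _ a b]
  = (1 + (w * a%:R / M%:R) +i* (w * b%:R / M%:R)) ^+ M.
Proof.
rewrite /exp_approx horner_exp hornerMXaddC hornerC gausspE addrC.
congr ((1 + _) ^+ M); apply/eqP; rewrite eq_complex /= !mul0r subr0 addr0.
by apply/andP; split; apply/eqP; ring.
Qed.

(** The bound is independent of [M], so [M] can be taken as large as the approximation demands. *)
Lemma nrm_exp_approx w M (x : nat) : (0 < M)%N ->
  nrm x%:R (exp_approx w M) <= (exp (`|w| * x%:R))%:C.
Proof.
move=> M_gt0; have M_gt0R : 0 < M%:R :> R by rewrite ltr0n.
apply: le_trans (nrm_exp _ _ _) _ => //.
rewrite nrm_MXaddC // nrmC // norm_real_complex normr1.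
rewrite -(rmorph_nat (real_complex R) x) -rmorphM -(rmorph1 (real_complex R)) -rmorphD -rmorphXn lecR.
set t := `|w| / M%:R * x%:R.
have t_ge0 : 0 <= t by rewrite mulr_ge0 // divr_ge0.
have -> : `|w / M%:R| * x%:R = t by rewrite normrM normfV normr_nat.
have /RleP := one_plus_pow_le_exp t M (elimT RleP t_ge0).
rewrite RpowE RmultE INRE addrC /t.
by rewrite (_ : M%:R * _ = `|w| * x%:R) //; field; rewrite gt_eqF.
Qed.

(** If p/q were closer, [exp_approx] with huge [M] would contradict [no_approximation]. The
    tolerance 2^(-S) is halved between the error of [exp_approx] and that of replacing theta^a by
    (p/q)^a. *)
Lemma exp_rational_dist (m s p q : nat) :
  (96 * m <= s)%N -> (0 < s)%N -> (24 * (20 * s) ^ 3 <= 2 ^ s)%N ->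
  (0 < p)%N -> (p < q)%N -> (q <= 2 ^ s)%N ->
  2 ^- (20 * s * (20 * s) ^ 6 + 1 + s)
    <= `|exp (Ropp (Rmult (Rmult (IZR 2) PI) (INR m))) - p%:R / q%:R| :> R.
Proof.
move=> ms s_gt0 s_large p_gt0 pq q_le.
rewrite leNgt; apply/negP => close.
set w : R := (Ropp (Rmult (Rmult (IZR 2) PI) (INR m))) in close.
set S := (20 * s * (20 * s) ^ 6)%N in close.
set J := (4 * (20 * s) ^ 3)%N.
have w_le0 : w <= 0.
  by rewrite /w RoppE oppr_le0; apply/RleP/two_PI_INR_ge0.
pose B := (`|w| * J%:R + `|w| * J%:R)%R.
have B_ge0 : 0 <= B by rewrite addr_ge0 // mulr_ge0.
(* Any M > D meets both needs: 2 B <= M, and an error of at most 2^(-(S + 1)) in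
   [one_plus_pow_cexp]. *)
pose D := (2 * B + 4 * B ^+ 2 * exp B * 2 ^+ S.+1)%R.
have expB_ge0 : 0 <= exp B by apply/RleP; left; exact: exp_pos.
have D1_ge0 : 0 <= 4 * B ^+ 2 * exp B * 2 ^+ S.+1.
  by apply: mulr_ge0; rewrite ?exprn_ge0 ?mulr_ge0 ?exprn_ge0.
have D_ge0 : 0 <= D by rewrite addr_ge0 // mulr_ge0.
have := archi_boundP D_ge0; set M := Num.bound D => DM.
have M_gt0R : 0 < M%:R :> R by apply: le_lt_trans DM.
have M_gt0 : (0 < M)%N by rewrite -(ltr0n R).
apply: (@no_approximation (complex R) s p q (exp_approx w M)) => //.
- move=> n; apply: le_trans (nrm_exp_approx _ _ M_gt0) _.
  rewrite -(rmorph_nat (real_complex R)) lecR.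
  have -> : `|w| = Rmult (Rmult (IZR 2) PI) (INR m).
    by rewrite /w RoppE normrN ger0_norm //; apply/RleP/two_PI_INR_ge0.
  have /RleP := exp_2PI_le m n s (elimT ssrnat.leP ms).
  by rewrite RpowE natrX -(INRE (6 * n)).
move=> a b aJ bJ; rewrite -/S -/J in aJ bJ *.
rewrite horner_exp_approx.
have [expE [cosE sinE]] := exp_2PI_gaussian m a b.
have cexpE : cexp (w * a%:R) (w * b%:R) = ((exp w)%:C) ^+ a.
  rewrite -!INRE /cexp -!RmultE expE cosE sinE -rmorphXn RpowE.
  by apply/eqP; rewrite eq_complex /= !RmultE mulr1 mulr0 !eqxx.
set r : complex R := p%:R / q%:R.
rewrite -(subrK ((exp w)%:C ^+ a) ((1 + _) ^+ M)) -addrA.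
apply: le_trans (ler_normD _ _) _.
have -> : (2 ^+ S)^-1 = (2 ^+ S.+1)^-1 + (2 ^+ S.+1)^-1 :> complex R.
  have h2 : 2^-1 + 2^-1 = 1 :> complex R by field.
  by rewrite [2 ^+ S.+1]exprS invfM -mulrDl h2 mul1r.
have twoC : (2 ^+ S.+1)^-1 = ((2 ^+ S.+1)^-1)%:C :> complex R.
  by rewrite fmorphV rmorphXn rmorph_nat.
apply: lerD; rewrite twoC.
  rewrite -cexpE; apply: le_trans (one_plus_pow_cexp (B := B) _ M_gt0 _) _.
  - by rewrite /B !normrM !normr_nat lerD // ler_wpM2l // ler_nat.
  - by apply: ltW; apply: le_lt_trans DM; rewrite /D lerDl.
  - rewrite lecR ler_pdivrMr // ler_pdivlMl ?exprn_gt0 //.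
    rewrite mulrC; apply: ltW; apply: le_lt_trans DM.
    by rewrite /D lerDr mulr_ge0.
have q_gt0 : 0 < q%:R :> R by rewrite ltr0n (leq_trans _ pq).
have rE : r = (p%:R / q%:R)%:C by rewrite rmorphM fmorphV !rmorph_nat.
rewrite rE -!(rmorphXn (real_complex R)) -rmorphB norm_real_complex.
rewrite lecR.
have r_le1 : `|p%:R / q%:R| <= 1 :> R.
  rewrite ger0_norm; last by rewrite divr_ge0.
  by rewrite ler_pdivrMr // mul1r ler_nat ltnW.
have e_le1 : `|exp w| <= 1.
  rewrite ger0_norm; last by apply/RleP; left; exact: exp_pos.
  by rewrite -expR0; apply/RleP/exp_mono/RleP.
(* Both numbers are at most 1, so the a-th powers differ by at most a times the distance; a <= J <=
   2^s uses up the term s of the exponent. *)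
apply: le_trans (exprB_le a (lexx 1) e_le1 r_le1 (ltW close)) _.
have J_le : (J <= 2 ^ s)%N by apply: leq_trans s_large; rewrite leq_mul2r orbT.
rewrite expr1n mulr1 addn1 exprD invfM mulrCA ler_piMr ?invr_ge0 ?exprn_ge0 //.
by rewrite ler_pdivrMr ?exprn_gt0 // mul1r -natrX ler_nat (leq_trans aJ).
Qed.

(** The same bound in the notation of the standard library, with base 2 weakened to base e. *)
Lemma exp_rational_dist_R (m s p q : nat) :
  (96 * m <= s)%coq_nat -> (1 <= s)%coq_nat ->
  Rle (24 * (20 * INR s) ^ 3) (2 ^ s) ->
  (1 <= p)%coq_nat -> (p < q)%coq_nat -> Rle (INR q) (2 ^ s) ->
  Rle (exp (- (20 * INR s * (20 * INR s) ^ 6 + 1 + INR s)))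
      (Rabs (exp (- (2 * PI * INR m)) - INR p / INR q)).
Proof.
move=> /ssrnat.leP ms /ssrnat.leP s_gt0 s_large /ssrnat.leP p_gt0 /ssrnat.ltP pq q_le.
have IZRn n : IZR (Z.of_nat n) = n%:R by rewrite -INR_IZR_INZ INRE.
have I2 := IZRn 2%N; have I20 := IZRn 20%N; have I24 := IZRn 24%N.
rewrite /= in I2 I20 I24.
have := @exp_rational_dist m s p q ms s_gt0 _ p_gt0 pq _.
set e := (20 * s * (20 * s) ^ 6 + 1 + s)%N => H.
have eE : Rplus (Rplus (20 * INR s * (20 * INR s) ^ 6) 1) (INR s) = INR e.
  by rewrite !INRE /e !natrD natrM natrX natrM I20 RpowE.
rewrite eE; apply: Rle_trans (exp_opp_le_pow2 e) _.
apply/RleP; rewrite I2 RpowE (INRE p) (INRE q); apply: H.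
  move/RleP: s_large; rewrite I24 I20 I2 !RpowE INRE => s_large.
  by rewrite -(ler_nat R) natrM !natrX natrM.
by move/RleP: q_le; rewrite I2 RpowE INRE -natrX ler_nat.
Qed.

End ExpRational.

(** * The divisor sum *)

Lemma sum_1_to_ext f g N :
  (forall n, (1 <= n <= N)%nat -> f n = g n) -> sum_1_to f N = sum_1_to g N.
Proof.
induction N as [|N IH]; intros H; [reflexivity|]. simpl.
rewrite IH, H; [reflexivity|lia|intros; apply H; lia].
Qed.

Lemma sum_1_to_le f g N :
  (forall n, (1 <= n <= N)%nat -> f n <= g n) -> sum_1_to f N <= sum_1_to g N.
Proof.
induction N as [|N IH]; intros H; simpl; [lra|].
apply Rplus_le_compat; [apply IH; intros; apply H|apply H]; lia.
Qed.

Lemma sum_1_to_plus f g N :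
  sum_1_to (fun n => f n + g n) N = sum_1_to f N + sum_1_to g N.
Proof. induction N as [|N IH]; simpl; [ring|rewrite IH; ring]. Qed.

Lemma sum_1_to_scal c f N : sum_1_to (fun n => c * f n) N = c * sum_1_to f N.
Proof. induction N as [|N IH]; simpl; [ring|rewrite IH; ring]. Qed.

Lemma sum_1_to_const c N : sum_1_to (fun _ => c) N = INR N * c.
Proof. induction N as [|N IH]; [simpl; ring|]. rewrite S_INR; simpl; rewrite IH; ring. Qed.

Lemma sum_1_to_abs f N : Rabs (sum_1_to f N) <= sum_1_to (fun n => Rabs (f n)) N.
Proof.
induction N as [|N IH]; simpl; [rewrite Rabs_R0; lra|].
eapply Rle_trans; [apply Rabs_triang|lra].
Qed.

Lemma sum_1_to_swap (f : nat -> nat -> R) M N :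
  sum_1_to (fun i => sum_1_to (f i) N) M
  = sum_1_to (fun j => sum_1_to (fun i => f i j) M) N.
Proof.
induction M as [|M IH]; simpl.
- rewrite sum_1_to_const; ring.
- rewrite IH, sum_1_to_plus; reflexivity.
Qed.

(** * The hyperbola method *)

Lemma sum_1_to_app f a b :
  sum_1_to f (a + b) = sum_1_to f a + sum_1_to (fun i => f (a + i)%nat) b.
Proof.
induction b as [|b IH]; [rewrite Nat.add_0_r; simpl; ring|].
rewrite Nat.add_succ_r; simpl; rewrite IH, Nat.add_succ_r; ring.
Qed.

(** Written with an indicator, inner ranges no longer depend on the outer index, and [sum_1_to_swap]
    applies. *)
Lemma sum_1_to_trunc f b N : (b <= N)%nat ->
  sum_1_to (fun j => if (j <=? b)%nat then f j else 0) N = sum_1_to f b.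
Proof.
intros H. replace N with (b + (N - b))%nat by lia. rewrite sum_1_to_app.
rewrite (sum_1_to_ext (fun i => if (b + i <=? b)%nat then _ else 0) (fun _ => 0)).
- rewrite sum_1_to_const, Rmult_0_r, Rplus_0_r. apply sum_1_to_ext.
  intros n Hn. destruct (Nat.leb_spec n b); [reflexivity|lia].
- intros n Hn. destruct (Nat.leb_spec (b + n) b); [lia|reflexivity].
Qed.

(** The range is extended to a common N for the same purpose; an index k > n adds 0, because n mod k
    = n is nonzero. *)
Lemma ndivisors_sum n N : (1 <= n <= N)%nat ->
  INR (ndivisors n) = sum_1_to (fun k => if (n mod k =? 0)%nat then 1 else 0) N.
Proof.
intros Hn. unfold ndivisors.
assert (H : forall M, INR (length (filter (fun k => (n mod k =? 0)%nat) (seq 1 M)))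
  = sum_1_to (fun k => if (n mod k =? 0)%nat then 1 else 0) M).
{ induction M as [|M IH]; [reflexivity|].
  rewrite seq_S, filter_app, length_app, plus_INR, IH. cbn [sum_1_to].
  f_equal. change (1 + M)%nat with (S M). cbn [filter].
  destruct (n mod S M =? 0)%nat; reflexivity. }
rewrite H. replace N with (n + (N - n))%nat by lia. rewrite sum_1_to_app.
rewrite (sum_1_to_ext _ (fun _ => 0) (N - n)).
- rewrite sum_1_to_const; ring.
- intros i Hi. rewrite Nat.mod_small by lia.
  destruct (Nat.eqb_spec n 0); [lia|reflexivity].
Qed.

Lemma sum_1_to_multiples f k N : (1 <= k)%nat ->
  sum_1_to (fun n => (if (n mod k =? 0)%nat then 1 else 0) * f n) N
  = sum_1_to (fun j => f (k * j)%nat) (N / k).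
Proof.
intros Hk. induction N as [|N IH].
- rewrite Nat.div_small by lia; reflexivity.
- cbn [sum_1_to]. rewrite IH.
  pose proof (Nat.div_mod N k ltac:(lia)) as D1.
  pose proof (Nat.div_mod (S N) k ltac:(lia)) as D2.
  pose proof (Nat.mod_upper_bound N k ltac:(lia)) as M1.
  pose proof (Nat.mod_upper_bound (S N) k ltac:(lia)) as M2.
  destruct (Nat.eqb_spec (S N mod k) 0) as [E|E].
  + assert (Hq : (S N / k = S (N / k))%nat) by nia.
    rewrite Hq. cbn [sum_1_to]. replace (k * S (N / k))%nat with (S N) by nia. ring.
  + assert (Hq : (S N / k = N / k)%nat) by nia.
    rewrite Hq. ring.
Qed.

Lemma sum_ndivisors f N :
  sum_1_to (fun n => INR (ndivisors n) * f n) N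
  = sum_1_to (fun k => sum_1_to (fun j => f (k * j)%nat) (N / k)) N.
Proof.
transitivity (sum_1_to (fun n => sum_1_to
   (fun k => (if (n mod k =? 0)%nat then 1 else 0) * f n) N) N).
- apply sum_1_to_ext. intros n Hn. rewrite (ndivisors_sum n N Hn), Rmult_comm.
  rewrite <- sum_1_to_scal. apply sum_1_to_ext. intros; ring.
- rewrite sum_1_to_swap. apply sum_1_to_ext. intros k Hk.
  apply sum_1_to_multiples; lia.
Qed.

(** Split the pairs k j <= N at k = s. Those with k > s have j <= s because N < (s + 1)^2; in them j
    is taken as the outer variable d and k = s + i. *)
Lemma hyperbola f N s : (N < (s + 1) * (s + 1))%nat -> (s <= N)%nat ->
  sum_1_to (fun n => INR (ndivisors n) * f n) N
  = sum_1_to (fun d => sum_1_to (fun j => f (j * d)%nat) (N / d)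
                     + sum_1_to (fun i => f ((s + i) * d)%nat) (N / d - s)) s.
Proof.
intros Hs HsN. rewrite sum_ndivisors, sum_1_to_plus.
set (F := fun k => sum_1_to (fun j => f (k * j)%nat) (N / k)).
replace (sum_1_to F N) with (sum_1_to F (s + (N - s))) by (f_equal; lia).
rewrite sum_1_to_app. unfold F; clear F. f_equal.
{ apply sum_1_to_ext; intros; apply sum_1_to_ext; intros; f_equal; lia. }
transitivity (sum_1_to (fun i => sum_1_to
  (fun j => if (j <=? N / (s + i))%nat then f ((s + i) * j)%nat else 0) N) (N - s)).
{ apply sum_1_to_ext. intros i Hi. symmetry. apply sum_1_to_trunc.
  apply Nat.Div0.div_le_upper_bound. nia. }
rewrite sum_1_to_swap.
transitivity (sum_1_to (fun j => if (j <=? s)%nat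
  then sum_1_to (fun i => f ((s + i) * j)%nat) (N / j - s) else 0) N).
2: now apply sum_1_to_trunc.
apply sum_1_to_ext. intros j Hj.
(* Both tests say (s + i) j <= N; i >= 1 makes the truncated subtraction harmless. *)
assert (E : forall i, (1 <= i)%nat ->
  ((j <=? N / (s + i)) = (i <=? N / j - s))%nat).
{ intros i Hi. apply Bool.eq_iff_eq_true. rewrite !Nat.leb_le. split; intros H.
  - assert (s + i <= N / j)%nat; [|lia]. apply Nat.div_le_lower_bound; [lia|].
    pose proof (Nat.Div0.mul_div_le N (s + i)). nia.
  - apply Nat.div_le_lower_bound; [lia|].
    pose proof (Nat.Div0.mul_div_le N j). nia. }
destruct (Nat.leb_spec j s).
- rewrite <- (sum_1_to_trunc _ (N / j - s) (N - s)).
  + apply sum_1_to_ext. intros i Hi. now rewrite E by lia.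
  + assert (N / j <= N)%nat; [|lia]. apply Nat.Div0.div_le_upper_bound. nia.
- rewrite (sum_1_to_ext _ (fun _ => 0)); [rewrite sum_1_to_const; ring|].
  intros i Hi. rewrite E by lia. destruct (Nat.leb_spec i (N / j - s)); [|reflexivity].
  pose proof (Nat.Div0.mul_div_le N j). nia.
Qed.

(** * Exponential sums over progressions *)

Section Phase.
Variables t c e : R.
Hypothesis unit_ce : c * c + e * e = 1.

(** The projection of e(n t) on the unit direction (c, e), which keeps all sums real. *)
Definition phase (n : nat) : R :=
  c * cos (2 * PI * INR n * t) + e * sin (2 * PI * INR n * t).

(** Cauchy-Schwarz through Lagrange's identity. *)
Lemma rotation_le_1 y z : y * y + z * z = 1 -> Rabs (c * y + e * z) <= 1.
Proof.
intros H.
assert (E : (c * y + e * z) ^ 2 + (c * z - e * y) ^ 2 = (c * c + e * e) * (y * y + z * z))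
  by ring.
rewrite unit_ce, H in E. pose proof (pow2_ge_0 (c * z - e * y)).
set (p := c * y + e * z) in *. clearbody p. apply Rabs_le. split; nra.
Qed.

Lemma sin2_cos2_mul y : cos y * cos y + sin y * sin y = 1.
Proof. rewrite <- (sin2_cos2 y). unfold Rsqr. ring. Qed.

Lemma phase_le_1 n : Rabs (phase n) <= 1.
Proof. apply rotation_le_1, sin2_cos2_mul. Qed.

Lemma phase_sum_le g b : Rabs (sum_1_to (fun i => phase (g i)) b) <= INR b.
Proof.
eapply Rle_trans; [apply sum_1_to_abs|].
rewrite <- (Rmult_1_r (INR b)), <- sum_1_to_const.
apply sum_1_to_le; intros; apply phase_le_1.
Qed.

(** With y = pi d t, each term telescopes by 2 sin y cos(2 k y) = sin((2k + 1) y) - sin((2k - 1) y)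
    and its analogue for the sine. *)
Lemma phase_sum_telescope a b d :
  2 * sin (PI * INR d * t) * sum_1_to (fun i => phase ((a + i) * d)) b
  = (c * sin ((2 * INR (a + b) + 1) * (PI * INR d * t))
     + e * - cos ((2 * INR (a + b) + 1) * (PI * INR d * t)))
  - (c * sin ((2 * INR a + 1) * (PI * INR d * t))
     + e * - cos ((2 * INR a + 1) * (PI * INR d * t))).
Proof.
set (y := PI * INR d * t).
induction b as [|b IH]; [rewrite Nat.add_0_r; simpl; ring|].
simpl sum_1_to. rewrite Rmult_plus_distr_l, IH. unfold phase.
replace (2 * PI * INR ((a + S b) * d) * t) with (2 * INR (a + S b) * y)
  by (rewrite mult_INR; unfold y; ring).
replace ((2 * INR (a + S b) + 1) * y) with (2 * INR (a + S b) * y + y) by ring.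
replace ((2 * INR (a + b) + 1) * y) with (2 * INR (a + S b) * y - y)
  by (rewrite Nat.add_succ_r, S_INR; ring).
rewrite sin_plus, cos_plus, sin_minus, cos_minus. ring.
Qed.

Lemma phase_sum_sin_le a b d :
  Rabs (sum_1_to (fun i => phase ((a + i) * d)) b) * Rabs (sin (PI * INR d * t)) <= 1.
Proof.
rewrite <- Rabs_mult.
assert (Hr : forall y, Rabs (c * sin y + e * - cos y) <= 1).
{ intros y. apply rotation_le_1. pose proof (sin2_cos2_mul y). lra. }
pose proof (phase_sum_telescope a b d) as H.
pose proof (Hr ((2 * INR (a + b) + 1) * (PI * INR d * t))) as H1.
pose proof (Hr ((2 * INR a + 1) * (PI * INR d * t))) as H2.
apply Rcomplements.Rabs_le_between in H1, H2.
apply Rabs_le. split; lra.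
Qed.

End Phase.

(** * The sine and the distance to the nearest integer *)

Lemma Rabs_sin_PI_ge v : Rabs v <= 1 / 2 -> Rabs v <= Rabs (sin (PI * v)).
Proof.
assert (H : forall w, 0 <= w <= 1 / 2 -> w <= sin (PI * w)).
{ intros w Hw. pose proof PI_4. pose proof PI2_3_2.
  assert (Hx : 0 <= PI * w <= 2) by nra.
  destruct (sin_bound (PI * w) 0) as [Hl _]; try nra.
  (* For x = pi w <= 2, sin x >= x - x^3 / 6 >= x / 3 >= w. *)
  unfold sin_approx, sin_term in Hl; simpl in Hl.
  set (x := PI * w) in *.
  assert (3 * w <= x) by (unfold x; nra).
  assert (x * x <= 4) by nra.
  assert (x * (x * x) <= x * 4) by (apply Rmult_le_compat_l; lra).
  nra. }
intros Hv. destruct (Rle_lt_dec 0 v).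
- rewrite Rabs_right in * by lra. pose proof (H v ltac:(lra)).
  rewrite Rabs_right by lra. lra.
- rewrite Rabs_left in * by lra. pose proof (H (- v) ltac:(lra)) as Hs.
  replace (PI * - v) with (- (PI * v)) in Hs by ring.
  rewrite sin_neg in Hs. rewrite Rabs_left by lra. lra.
Qed.

Lemma Rabs_sin_add_nat_PI z p : Rabs (sin (z + INR p * PI)) = Rabs (sin z).
Proof.
induction p as [|p IH]; [simpl; do 2 f_equal; ring|].
rewrite S_INR. replace (z + (INR p + 1) * PI) with (z + INR p * PI + PI) by ring.
rewrite neg_sin, Rabs_Ropp. exact IH.
Qed.

Lemma Rabs_sin_PI_dist y delta : 0 <= y ->
  (forall p : nat, delta <= Rabs (y - INR p)) -> delta <= Rabs (sin (PI * y)).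
Proof.
intros Hy H. destruct (Rcomplements.nfloor_ex y Hy) as [n Hn].
assert (E : exists p, Rabs (y - INR p) <= 1 / 2).
{ destruct (Rle_lt_dec (y - INR n) (1 / 2)).
  - exists n. apply Rabs_le; lra.
  - exists (S n). rewrite S_INR. apply Rabs_le; lra. }
destruct E as [p Hp]. apply Rle_trans with (1 := H p).
replace (PI * y) with (PI * (y - INR p) + INR p * PI) by ring.
rewrite Rabs_sin_add_nat_PI. now apply Rabs_sin_PI_ge.
Qed.

Lemma harmonic_le T : (1 <= T)%nat -> sum_1_to (fun t => / INR t) T <= 1 + ln (INR T).
Proof.
induction T as [|T IH]; intros HT; [lia|].
destruct T as [|T]; [simpl; rewrite ln_1; lra|].
cbn [sum_1_to] in *. specialize (IH ltac:(lia)).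
assert (P1 : 0 < INR (S T)) by (apply lt_0_INR; lia).
assert (P2 : 0 < INR (S (S T))) by (apply lt_0_INR; lia).
pose proof (exp_ineq1_le (ln (INR (S T) / INR (S (S T))))) as H.
rewrite exp_ln in H by now apply Rdiv_lt_0_compat.
unfold Rdiv in H at 1. rewrite ln_mult, ln_Rinv in H by (try apply Rinv_0_lt_compat; assumption).
replace (INR (S T) / INR (S (S T))) with (1 - / INR (S (S T))) in H.
- lra.
- rewrite (S_INR (S T)). field. rewrite <- S_INR. lra.
Qed.

(** * Sums over blocks of length Q *)

Section Blocks.
Variables (U sigma : nat -> R) (delta X : R) (Q : nat).
Hypothesis delta_pos : 0 < delta.
Hypothesis X_ge0 : 0 <= X.
Hypothesis Q_ge1 : (1 <= Q)%nat.
Hypothesis U_ge0 : forall d, 0 <= U d.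
Hypothesis U_le : forall d, (1 <= d)%nat -> U d * INR d <= X.
Hypothesis U_sigma : forall d, (1 <= d)%nat -> U d * sigma d <= 2.
Hypothesis sigma_ge : forall t, (1 <= t <= Q)%nat -> delta <= sigma t.
Hypothesis sigma_sub : forall d t, sigma t <= sigma d + sigma (d + t)%nat.

Lemma U_le_far d : (1 <= d)%nat -> delta / 2 <= sigma d -> U d <= 4 / delta.
Proof.
intros Hd H. pose proof (U_sigma d Hd). pose proof (U_ge0 d).
apply Rcomplements.Rle_div_r; [lra|]. nra.
Qed.

(* Two indices of a block with small [sigma] would differ by some [t <= Q] with
   [sigma t < delta], so a block contains at most one. *)
Lemma block_le a b : (1 <= a)%nat -> (b <= Q)%nat ->
  sum_1_to (fun i => U (a + i)) b <= INR b * (4 / delta) \/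
  (exists i, (1 <= i <= b)%nat /\ sigma (a + i) < delta / 2) /\
  sum_1_to (fun i => U (a + i)) b <= INR b * (4 / delta) + X / INR a.
Proof.
intros Ha. assert (Pa : 0 < INR a) by (apply lt_0_INR; lia).
assert (P4 : 0 < 4 / delta) by (apply Rdiv_lt_0_compat; lra).
induction b as [|b IH]; intros Hb; [left; simpl; lra|].
specialize (IH ltac:(lia)). cbn [sum_1_to]. rewrite S_INR.
destruct (Rle_lt_dec (delta / 2) (sigma (a + S b))) as [Hs|Hs].
- pose proof (U_le_far (a + S b) ltac:(lia) Hs).
  destruct IH as [IH|[(i & Hi & Hsi) IH]]; [left; lra|right].
  split; [exists i; split; [lia|assumption]|lra].
- destruct IH as [IH|[(i & Hi & Hsi) IH]].
  + right. split; [exists (S b); split; [lia|assumption]|].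
    pose proof (U_le (a + S b) ltac:(lia)) as HU. pose proof (U_ge0 (a + S b)).
    assert (INR a <= INR (a + S b)) by (apply le_INR; lia).
    assert (U (a + S b) <= X / INR a); [|lra].
    apply Rcomplements.Rle_div_r; [lra|]. nra.
  + exfalso. pose proof (sigma_ge (S b - i) ltac:(lia)) as H1.
    pose proof (sigma_sub (a + i) (S b - i)) as H2.
    replace (a + i + (S b - i))%nat with (a + S b)%nat in H2 by lia. lra.
Qed.

(** The first block 1..Q has no exceptional index, by [sigma_ge]. The block that starts after t Q
    has at most one, costing X / (t Q); these costs add up to a harmonic sum. *)
Lemma blocks_le T :
  sum_1_to U (S T * Q) <=
  INR (S T * Q) * (4 / delta) + X / INR Q * sum_1_to (fun t => / INR t) T.
Proof.
assert (P4 : 0 < 4 / delta) by (apply Rdiv_lt_0_compat; lra).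
assert (PQ : 0 < INR Q) by (apply lt_0_INR; lia).
induction T as [|T IH].
- simpl sum_1_to at 2. rewrite Nat.mul_1_l, Rmult_0_r, Rplus_0_r, <- sum_1_to_const.
  apply sum_1_to_le. intros d Hd. apply U_le_far; [lia|].
  pose proof (sigma_ge d Hd). lra.
- replace (S (S T) * Q)%nat with (S T * Q + Q)%nat by lia.
  rewrite sum_1_to_app, plus_INR. cbn [sum_1_to].
  assert (PT : 0 < INR (S T)) by (apply lt_0_INR; lia).
  assert (E : X / INR Q * / INR (S T) = X / INR (S T * Q))
    by (rewrite mult_INR; field; lra).
  assert (0 <= X / INR (S T * Q)).
  { rewrite mult_INR. apply Rcomplements.Rdiv_le_0_compat; [assumption|].
    now apply Rmult_lt_0_compat. }
  destruct (block_le (S T * Q) Q ltac:(nia) (Nat.le_refl Q)) as [H1|[_ H1]];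
  rewrite Rmult_plus_distr_l, E; lra.
Qed.

End Blocks.

(** Bounds |t theta - p| below for every p. For p = 0 it is at least theta >= exp(-s); for 0 < p < t
    the rational p/t is not too close to theta; for p >= t it is at least 1/2 since theta <= 1/2. *)
Lemma sin_small_multiples (m s t : nat) :
  (1 <= m)%nat -> (96 * m <= s)%nat -> 24 * (20 * INR s) ^ 3 <= 2 ^ s ->
  (1 <= t)%nat -> INR t <= 2 ^ s ->
  exp (- (20 * INR s * (20 * INR s) ^ 6 + 1 + INR s))
  <= Rabs (sin (PI * INR t * exp (- (2 * PI * INR m)))).
Proof.
intros Hm Hs Hlarge Ht Hts. set (theta := exp (- (2 * PI * INR m))).
set (D := 20 * INR s * (20 * INR s) ^ 6 + 1 + INR s).
assert (Ps : 0 <= INR s) by apply pos_INR.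
assert (PD : INR s + 1 <= D).
{ unfold D. assert (0 <= 20 * INR s * (20 * INR s) ^ 6); [|lra].
  apply Rmult_le_pos; [lra|apply pow_le; lra]. }
assert (Pm : 1 <= INR m) by (now apply (le_INR 1)).
assert (Pt : 1 <= INR t) by (now apply (le_INR 1)).
pose proof PI2_3_2 as HPI.
assert (Ptheta : 0 < theta) by apply exp_pos.
assert (Htheta : theta <= 1 / 2).
{ unfold theta. rewrite exp_Ropp. apply Rle_trans with (/ 2); [|lra].
  apply Rinv_le_contravar; [lra|].
  pose proof (exp_ineq1_le (2 * PI * INR m)). nra. }
assert (Hhalf : exp (- D) <= 1 / 2).
{ rewrite exp_Ropp. apply Rle_trans with (/ 2); [|lra].
  apply Rinv_le_contravar; [lra|]. pose proof (exp_ineq1_le D). lra. }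
rewrite Rmult_assoc. apply Rabs_sin_PI_dist; [nra|]. intros p.
destruct (Nat.eq_dec p 0) as [->|Hp].
- simpl. rewrite Rminus_0_r, Rabs_right by nra.
  apply Rle_trans with theta; [|nra]. unfold theta. apply exp_mono.
  apply Ropp_le_contravar. pose proof PI_4.
  assert (INR (96 * m) <= INR s) by now apply le_INR.
  rewrite mult_INR in *. replace (INR 96) with 96 in * by (simpl; ring). nra.
- destruct (Nat.lt_ge_cases p t) as [Hpt|Hpt].
  + pose proof (@ExpRational.exp_rational_dist_R m s p t Hs ltac:(lia) Hlarge ltac:(lia) Hpt Hts)
      as H. fold theta D in H.
    replace (INR t * theta - INR p) with (INR t * (theta - INR p / INR t)) by (field; lra).
    rewrite Rabs_mult, (Rabs_right (INR t)) by lra.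
    pose proof (Rabs_pos (theta - INR p / INR t)). nra.
  + apply le_INR in Hpt. rewrite Rabs_left by nra. nra.
Qed.

Lemma cube_le_pow2 s : (96 <= s)%nat -> 24 * (20 * INR s) ^ 3 <= 2 ^ s.
Proof.
intros Hs. induction Hs as [|s Hs IH].
- replace (INR 96) with 96 by (simpl; ring).
  replace (24 * (20 * 96) ^ 3) with 169869312000 by ring.
  rewrite pow_IZR. apply IZR_le. now vm_compute.
- rewrite S_INR. apply le_INR in Hs.
  replace (INR 96) with 96 in Hs by (simpl; ring).
  simpl pow in *. nra.
Qed.

(* log (1/delta): the exponent of [exp_rational_dist_R] for s = 96 h. *)
Definition log_inv_delta (h : R) : R := 20 * (96 * h) * (20 * (96 * h)) ^ 6 + 1 + 96 * h.

Lemma sum_1_to_incr f a b :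
  (forall n, 0 <= f n) -> (a <= b)%nat -> sum_1_to f a <= sum_1_to f b.
Proof.
intros Hf Hab. replace b with (a + (b - a))%nat by lia. rewrite sum_1_to_app.
assert (0 <= sum_1_to (fun i => f (a + i)%nat) (b - a)); [|lra].
rewrite <- (Rmult_0_r (INR (b - a))), <- sum_1_to_const.
apply sum_1_to_le; auto.
Qed.

(** [blocks_le] with Q = 2^h, X = 2N and s = 96 h. The s0 + 1 blocks more than cover d <= s0; the
    excess affects only the first term, which has sqrt N to spare. *)
Lemma divisor_phase_sum_le (m h N : nat) (c e : R) :
  (1 <= m <= h)%nat -> (1 <= N)%nat -> c * c + e * e = 1 ->
  Rabs (sum_1_to (fun n => INR (ndivisors n)
                           * phase (exp (- (2 * PI * INR m))) c e n) N)
  <= 8 * sqrt (INR N) * 2 ^ h * exp (log_inv_delta (INR h))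
     + 2 * INR N / 2 ^ h * (1 + ln (INR N)).
Proof.
intros Hmh HN Hce. set (theta := exp (- (2 * PI * INR m))).
set (f := phase theta c e). set (s0 := Nat.sqrt N).
assert (Hs0 : (s0 * s0 <= N < S s0 * S s0)%nat) by (apply Nat.sqrt_spec; lia).
assert (Hs1 : (1 <= s0)%nat) by nia.
set (A := fun d => sum_1_to (fun j => f (j * d)%nat) (N / d)).
set (B := fun d => sum_1_to (fun i => f ((s0 + i) * d)%nat) (N / d - s0)).
(* The cut at [s0] lets the blocks overrun the hyperbola range at no cost. *)
set (U := fun d => if (d <=? s0)%nat then Rabs (A d) + Rabs (B d) else 0).
set (sigma := fun d => Rabs (sin (PI * INR d * theta))).
set (delta := exp (- log_inv_delta (INR h))).
assert (U_ge0 : forall d, 0 <= U d).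
{ intros d. unfold U. pose proof (Rabs_pos (A d)). pose proof (Rabs_pos (B d)).
  destruct (d <=? s0)%nat; lra. }
assert (HQ : INR (2 ^ h) = 2 ^ h) by (rewrite pow_INR; reflexivity).
assert (P2 : 0 < 2 ^ h) by (apply pow_lt; lra).
assert (Hblock : sum_1_to U (S s0 * 2 ^ h) <=
  INR (S s0 * 2 ^ h) * (4 / delta)
  + 2 * INR N / INR (2 ^ h) * sum_1_to (fun t => / INR t) s0).
{ apply (blocks_le U sigma).
  - apply exp_pos.
  - pose proof (pos_INR N); lra.
  - pose proof (Nat.pow_nonzero 2 h); lia.
  - exact U_ge0.
  - intros d Hd. unfold U. destruct (d <=? s0)%nat; [|pose proof (pos_INR N); lra].
    assert (HA : Rabs (A d) <= INR (N / d)) by now apply phase_sum_le.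
    assert (HB : Rabs (B d) <= INR (N / d)).
    { eapply Rle_trans; [now apply phase_sum_le|]. apply le_INR; lia. }
    assert (HD : INR (N / d) * INR d <= INR N).
    { rewrite <- mult_INR. apply le_INR. rewrite Nat.mul_comm. apply Nat.Div0.mul_div_le. }
    pose proof (pos_INR d). nra.
  - intros d Hd. unfold U. destruct (d <=? s0)%nat; [|lra].
    pose proof (phase_sum_sin_le theta c e Hce 0 (N / d) d) as HA.
    pose proof (phase_sum_sin_le theta c e Hce s0 (N / d - s0) d) as HB.
    rewrite Rmult_plus_distr_r. unfold A, B, f, sigma. simpl in HA. lra.
  - intros t Ht. unfold delta, sigma, log_inv_delta.
    pose proof (sin_small_multiples m (96 * h) t ltac:(lia) ltac:(nia)) as H.
    rewrite mult_INR in H. replace (INR 96) with 96 in H by (simpl; ring).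
    apply H.
    + replace (96 * INR h) with (INR (96 * h))
        by (rewrite mult_INR; simpl; ring). apply cube_le_pow2; lia.
    + lia.
    + apply Rle_trans with (2 ^ h).
      * rewrite <- HQ. apply le_INR; lia.
      * apply Rle_pow; [lra|lia].
  - intros d t. unfold sigma.
    replace (PI * INR t * theta)
      with (PI * INR (d + t) * theta - PI * INR d * theta) by (rewrite plus_INR; ring).
    set (y := PI * INR d * theta). set (z := PI * INR (d + t) * theta).
    rewrite sin_minus. unfold Rminus. eapply Rle_trans; [apply Rabs_triang|].
    rewrite Rabs_Ropp, !Rabs_mult, Rplus_comm.
    assert (Hc : forall w, Rabs (cos w) <= 1)
      by (intros w; apply Rabs_le; apply COS_bound).
    pose proof (Hc y). pose proof (Hc z).
    pose proof (Rabs_pos (sin y)). pose proof (Rabs_pos (sin z)). nra. }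
assert (Hmain : Rabs (sum_1_to (fun n => INR (ndivisors n) * f n) N)
  <= sum_1_to U (S s0 * 2 ^ h)).
{ rewrite (hyperbola f N s0) by nia. eapply Rle_trans; [apply sum_1_to_abs|].
  apply Rle_trans with (sum_1_to U s0).
  - apply sum_1_to_le. intros d Hd. unfold U.
    destruct (Nat.leb_spec d s0); [|lia]. apply Rabs_triang.
  - apply sum_1_to_incr; [exact U_ge0|]. pose proof (Nat.pow_nonzero 2 h). nia. }
eapply Rle_trans; [exact Hmain|]. eapply Rle_trans; [exact Hblock|].
assert (PN : 1 <= INR N) by now apply (le_INR 1).
assert (Ps0 : 1 <= INR s0) by now apply (le_INR 1).
rewrite HQ. apply Rplus_le_compat.
- replace (4 / delta) with (4 * exp (log_inv_delta (INR h)))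
    by (unfold delta; rewrite exp_Ropp; field; apply Rgt_not_eq, exp_pos).
  rewrite mult_INR, HQ, S_INR.
  assert (INR s0 <= sqrt (INR N)).
  { rewrite <- (sqrt_square (INR s0)) by lra. apply sqrt_le_1_alt.
    rewrite <- mult_INR. apply le_INR; lia. }
  pose proof (exp_pos (log_inv_delta (INR h))) as PE.
  assert (0 < 2 ^ h * exp (log_inv_delta (INR h))) by now apply Rmult_lt_0_compat.
  replace (8 * sqrt (INR N) * 2 ^ h * exp (log_inv_delta (INR h)))
    with (8 * sqrt (INR N) * (2 ^ h * exp (log_inv_delta (INR h)))) by ring.
  replace ((INR s0 + 1) * 2 ^ h * (4 * exp (log_inv_delta (INR h))))
    with (4 * (INR s0 + 1) * (2 ^ h * exp (log_inv_delta (INR h)))) by ring.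
  apply Rmult_le_compat_r; lra.
- apply Rmult_le_compat_l.
  + apply Rcomplements.Rdiv_le_0_compat; lra.
  + eapply Rle_trans; [now apply harmonic_le|].
    assert (ln (INR s0) <= ln (INR N)); [|lra].
    apply Rcomplements.ln_le; [lra|]. apply le_INR; nia.
Qed.

(* Testing against unit directions replaces the triangle inequality for complex sums. *)
Lemma cmod_le a b M : 0 <= M ->
  (forall c e, c * c + e * e = 1 -> Rabs (c * a + e * b) <= M) -> cmod a b <= M.
Proof.
intros HM H. unfold cmod. set (r := sqrt (a * a + b * b)).
assert (Hr : r * r = a * a + b * b) by (apply sqrt_sqrt; nra).
assert (Pr : 0 <= r) by apply sqrt_pos.
destruct (Req_dec r 0) as [E|E]; [lra|].
assert (Hu : a / r * (a / r) + b / r * (b / r) = 1).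
{ transitivity ((a * a + b * b) / (r * r)); [field; assumption|].
  rewrite Hr. field. rewrite <- Hr. nra. }
specialize (H _ _ Hu).
replace (a / r * a + b / r * b) with r in H.
- pose proof (Rle_abs r). lra.
- replace (a / r * a + b / r * b) with ((a * a + b * b) / r) by (field; assumption).
  rewrite <- Hr. field; assumption.
Qed.

(** * Sizes of the error terms *)

Lemma pow8_le_exp u : 0 <= u -> (u / 8) ^ 8 <= exp u.
Proof.
intros Hu. replace u with (INR 8 * (u / 8)) at 2 by (simpl; field).
rewrite exp_INR_mult. apply pow_incr. pose proof (exp_ineq1_le (u / 8)). lra.
Qed.

(** 1920 = 20 * 96, and 99 collects 96 h + 1 + 2 u. The degree 7 is why an eighth power below exp u
    is needed. *)
Lemma log_inv_delta_le h u : 0 <= h <= u -> 1 <= u ->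
  log_inv_delta h + 2 * u <= (1920 ^ 7 + 99) * u ^ 7.
Proof.
intros Hh Hu. unfold log_inv_delta.
replace (20 * (96 * h) * (20 * (96 * h)) ^ 6) with (1920 ^ 7 * h ^ 7) by ring.
assert (H7 : h ^ 7 <= u ^ 7) by (apply pow_incr; lra).
assert (H1 : u ^ 1 <= u ^ 7) by (apply Rle_pow; [lra|lia]).
rewrite pow_1 in H1.
set (k := 1920 ^ 7). assert (0 <= k) by (apply pow_le; lra). clearbody k. nra.
Qed.

(** As e^(1/2) <= 2, 2^(h + 1) exceeds e^(L/2) for h the integer part of L; hence the constant C =
    1/2. *)
Lemma exp_half_pow_le h L : L < INR h + 1 -> / 2 ^ h <= 2 * exp (- (1 / 2) * L).
Proof.
intros HL.
assert (E2 : exp (1 / 2) <= 2).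
{ assert (H : exp (1 / 2) * exp (1 / 2) = exp 1) by (rewrite <- exp_plus; f_equal; field).
  pose proof exp_le_3. pose proof (exp_pos (1 / 2)). nra. }
assert (H : exp (L / 2) <= 2 * 2 ^ h).
{ apply Rle_trans with (exp (INR (S h) * (1 / 2))).
  - apply exp_mono. rewrite S_INR. lra.
  - rewrite exp_INR_mult. change (2 * 2 ^ h) with (2 ^ S h).
    apply pow_incr. pose proof (exp_pos (1 / 2)). lra. }
replace (- (1 / 2) * L) with (- (L / 2)) by field. rewrite exp_Ropp.
assert (0 < 2 ^ h) by (apply pow_lt; lra). pose proof (exp_pos (L / 2)).
apply Rmult_le_reg_r with (2 ^ h * exp (L / 2)); [now apply Rmult_lt_0_compat|].
replace (/ 2 ^ h * (2 ^ h * exp (L / 2))) with (exp (L / 2)) by (field; lra).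
replace (2 * / exp (L / 2) * (2 ^ h * exp (L / 2))) with (2 * 2 ^ h) by (field; lra).
exact H.
Qed.

Theorem theorem1 :
  exists C A x0 : R, 0 < C /\ 0 < A /\
    forall (x : R) (N m : nat),
      x0 <= x ->
      INR N <= x < INR N + 1 ->
      (1 <= m)%nat ->
      INR m <= ln (ln x) / ln (ln (ln x)) ->
      cmod (div_exp_sum_re (exp (- (2 * PI * INR m))) N)
           (div_exp_sum_im (exp (- (2 * PI * INR m))) N)
      <= A * x * ln x * exp (- C * (ln (ln x) / ln (ln (ln x)))).
Proof.
set (K := 1920 ^ 7 + 99).
assert (PK : 99 <= K) by (pose proof (pow_le 1920 7 ltac:(lra)); unfold K; lra).
(* Chosen so that u >= u0 gives 2 K u^7 <= (u/8)^8 <= exp u = log x. *)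
set (u0 := 2 * 8 ^ 8 * K).
assert (Pu0 : 3 <= u0) by (unfold u0; lra).
(* 16 = 8 + 8, one for each term of [divisor_phase_sum_le]. *)
exists (1 / 2), 16, (exp (exp u0)).
split; [lra|]. split; [lra|]. intros x N m Hx HN Hm HmL.
assert (Px : 0 < x) by (pose proof (exp_pos (exp u0)); lra).
assert (Hlx : exp u0 <= ln x).
{ rewrite <- (ln_exp (exp u0)). apply Rcomplements.ln_le; [apply exp_pos|exact Hx]. }
assert (Hexpu0 : 4 <= exp u0) by (pose proof (exp_ineq1_le u0); lra).
set (u := ln (ln x)) in *.
assert (Hu : u0 <= u).
{ rewrite <- (ln_exp u0). apply Rcomplements.ln_le; [apply exp_pos|exact Hlx]. }
assert (Eu : exp u = ln x) by (apply exp_ln; lra).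
assert (Hlnu : 1 <= ln u).
{ rewrite <- (ln_exp 1). apply Rcomplements.ln_le; [apply exp_pos|].
  pose proof exp_le_3. lra. }
set (L := u / ln u) in *.
assert (Pm : 1 <= INR m) by now apply (le_INR 1).
assert (HLu : L <= u).
{ unfold L. apply Rcomplements.Rle_div_l; [lra|]. nra. }
destruct (Rcomplements.nfloor_ex L ltac:(lra)) as [h Hh].
assert (Hmh : (m <= h)%nat).
{ assert (INR m < INR (S h)) by (rewrite S_INR; lra).
  apply INR_lt in H. lia. }
assert (Hx1 : 1 <= x - 1) by (pose proof (exp_ineq1_le (exp u0)); lra).
assert (HN1 : (1 <= N)%nat) by (apply INR_le; simpl; lra).
assert (PN : 1 <= INR N) by now apply (le_INR 1).
set (E := exp (- (1 / 2) * L)).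
assert (PE : 0 < E) by apply exp_pos.
assert (HxlE : 0 < x * ln x * E) by (repeat apply Rmult_lt_0_compat; lra).
assert (Hsum : forall c e, c * c + e * e = 1 ->
  Rabs (c * div_exp_sum_re (exp (- (2 * PI * INR m))) N
        + e * div_exp_sum_im (exp (- (2 * PI * INR m))) N)
  <= 8 * sqrt (INR N) * 2 ^ h * exp (log_inv_delta (INR h))
     + 2 * INR N / 2 ^ h * (1 + ln (INR N))).
{ intros c e Hce. unfold div_exp_sum_re, div_exp_sum_im.
  rewrite <- !sum_1_to_scal, <- sum_1_to_plus.
  rewrite (sum_1_to_ext _
    (fun n => INR (ndivisors n) * phase (exp (- (2 * PI * INR m))) c e n)).
  - apply divisor_phase_sum_le; [lia|assumption|assumption].
  - intros n _. unfold phase. ring. }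
apply cmod_le; [lra|]. intros c e Hce.
eapply Rle_trans; [apply (Hsum c e Hce)|]. clear Hsum.
assert (P2h : 0 < 2 ^ h) by (apply pow_lt; lra).
assert (Hmajor : 2 * INR N / 2 ^ h * (1 + ln (INR N)) <= 8 * (x * ln x * E)).
{ pose proof (exp_half_pow_le h L ltac:(lra)) as Hh2. fold E in Hh2.
  assert (HlN : ln (INR N) <= ln x) by (apply Rcomplements.ln_le; lra).
  assert (HlN0 : 0 <= ln (INR N)) by (rewrite <- ln_1; apply Rcomplements.ln_le; lra).
  assert (Pi : 0 < / 2 ^ h) by now apply Rinv_0_lt_compat.
  apply Rle_trans with (2 * x * (2 * E) * (2 * ln x)); [|right; ring].
  unfold Rdiv. apply Rmult_le_compat; [|lra| |lra].
  - apply Rmult_le_pos; lra.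
  - apply Rmult_le_compat; lra. }
assert (Hminor : 8 * sqrt (INR N) * 2 ^ h * exp (log_inv_delta (INR h))
                 <= 8 * (x * E)).
{ assert (H2h : 2 ^ h <= exp u).
  { apply Rle_trans with (exp (INR h * 1)); [|apply exp_mono; lra].
    rewrite exp_INR_mult. apply pow_incr. pose proof (exp_ineq1_le 1). lra. }
  assert (Hsq : sqrt (INR N) <= exp (ln x / 2)).
  { rewrite <- (sqrt_square (exp (ln x / 2))) by (left; apply exp_pos).
    apply sqrt_le_1_alt. rewrite <- exp_plus.
    replace (ln x / 2 + ln x / 2) with (ln x) by field. rewrite exp_ln; lra. }
  (* Since L <= u, all terms besides (log x) / 2 total at most [log_inv_delta] + 2 u <= K u^7 <=
     (log x) / 2. *)
  assert (Hexpo : ln x / 2 + u + log_inv_delta (INR h) <= ln x - 1 / 2 * L).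
  { pose proof (log_inv_delta_le (INR h) u
      ltac:(split; [apply pos_INR|lra]) ltac:(lra)) as HD. fold K in HD.
    pose proof (pow8_le_exp u ltac:(lra)) as H8. rewrite Eu in H8.
    assert (Hu7 : 0 <= u ^ 7) by (apply pow_le; lra).
    assert (H9 : 2 * K * u ^ 7 <= (u / 8) ^ 8).
    { replace ((u / 8) ^ 8) with (u / 8 ^ 8 * u ^ 7) by field.
      apply Rmult_le_compat_r; [assumption|].
      unfold u0 in Hu. lra. }
    lra. }
  apply Rle_trans with (8 * exp (ln x / 2 + u + log_inv_delta (INR h))).
  - rewrite !exp_plus. rewrite <- !Rmult_assoc.
    apply Rmult_le_compat_r; [left; apply exp_pos|].
    pose proof (sqrt_pos (INR N)).
    apply Rmult_le_compat; lra.
  - apply Rmult_le_compat_l; [lra|]. unfold E.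
    replace x with (exp (ln x)) at 2 by (apply exp_ln; lra). rewrite <- exp_plus.
    apply exp_mono. lra. }
assert (x * E <= x * ln x * E) by nra.
lra.
Qed.
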